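(* Let $N\in\{11,17,19\}$ (the primes for which $\Gamma_0(N)$ has genus one). Let $\Delta>1$ be a fundamental discriminant that is congruent to a square modulo $4N$, let $p$ be a prime not dividing $\Delta$ nor $N$, and let $d$ be a positive integer such that $-d$ is congruent to a square modulo $4N$. Then $$H_N(\Delta,dp^2)\equiv\begin{cases}0\pmod p&\text{if }\left(\frac{-d}{p}\right)=1,\\H_N(\Delta,d)\pmod p&\text{if }\left(\frac{-d}{p}\right)=0,\\2H_N(\Delta,d)\pmod p&\text{if }\left(\frac{-d}{p}\right)=-1.\end{cases}$$
   Context: $(\frac{\cdot}{\cdot})$ is the Kronecker symbol, $\bar\Gamma_0(N)=\Gamma_0(N)/\{\pm I\}$. A congruence $x\equiv y\pmod p$ between rational numbers means $x-y\in p\mathbb Z$. For $d>0$, $\mathcal Q_{d\Delta,N}$ is the set of positive definite integral binary quadratic forms $Q=[a,b,Nc]=aX^2+bXY+cNY^2$ ($a,b,c\in\mathbb Z$) with $b^2-4Nac=-d\Delta$. Identify $Q$ with the matrix $\lambda_Q=\begin{pmatrix} b/2N&-a/N\\c&-b/2N\end{pmatrix}$; $\Gamma_0(N)$ acts by conjugation of $\lambda_Q$. The genus character is $$\chi_\Delta([a,b,Nc])=\begin{cases}\left(\frac{\Delta}{\nu}\right)&\text{if }\Delta\mid b^2-4Nac,\ (b^2-4Nac)/\Delta\text{ is a square mod }4N,\ \gcd(a,b,c,\Delta)=1,\\0&\text{otherwise,}\end{cases}$$ where $\nu$ is any integer prime to $\Delta$ represented by one of the forms $[N_1a,b,N_2c]$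 with $N_1N_2=N$, $N_1,N_2>0$. The twisted class number is $$H_N(\Delta,d)=\sum_{Q\in\mathcal Q_{d\Delta,N}/\bar\Gamma_0(N)}\frac{\chi_\Delta(Q)}{|\bar\Gamma_0(N)_Q|},$$ where $\bar\Gamma_0(N)_Q$ is the stabilizer of $Q$ (i.e. the twisted trace of the constant function $1$). *)

(* Defs.v *)
From mathcomp Require Export all_boot all_order all_algebra.
From mathcomp Require Export finmap.
From mathcomp Require Export mathcomp_extra boolp classical_sets functions.
From mathcomp Require Export cardinality fsbigop.

Set Implicit Arguments.
Unset Strict Implicit.
Unset Printing Implicit Defensive.

Export Order.TTheory GRing.Theory Num.Theory.
Local Open Scope classical_set_scope.
Local Open Scope ring_scope.

Definition square_mod (a m : int) : Prop := exists x : int, (x ^+ 2 = a %[mod m])%Z.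

Definition squarefree (m : int) : Prop :=
  forall q : nat, prime q -> ~~ ((q ^ 2)%N%:Z %| m)%Z.

(* The value 1 is included, as is customary. *)
Definition fundamental_discriminant (D : int) : Prop :=
  ((D = 1 %[mod 4])%Z /\ squarefree D) \/
  (exists m : int, [/\ D = 4 * m,
     (m = 2 %[mod 4])%Z \/ (m = 3 %[mod 4])%Z & squarefree m]).

(* Kronecker symbol (a / q) at a prime q: the Legendre symbol when q is odd. *)
Definition kronecker_prime (a : int) (q : nat) : int :=
  if (q%:Z %| a)%Z then 0
  else if q == 2%N then
    (if ((a %% 8)%Z == 1) || ((a %% 8)%Z == 7) then 1 else -1)
  else if `[< square_mod a q%:Z >] then 1 else -1.

Definition kronecker (a n : int) : int :=
  if n == 0 then (if `|a| == 1 then 1 else 0)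
  else (if (n < 0) && (a < 0) then -1 else 1) *
       \prod_(qe <- prime_decomp `|n|%N) kronecker_prime a qe.1 ^+ qe.2.

(* The triple (a, b, c) stands for the form [a, b, N c]; the level N is a
   separate argument of every function below. *)
Definition form : Type := (int * int * int)%type.

Definition coefa (Q : form) : int := Q.1.1.
Definition coefb (Q : form) : int := Q.1.2.
Definition coefc (Q : form) : int := Q.2.

Definition qf_eval (a b c x y : int) : int := a * x ^+ 2 + b * x * y + c * y ^+ 2.

Definition disc (N : nat) (Q : form) : int :=
  coefb Q ^+ 2 - 4 * N%:Z * coefa Q * coefc Q.

Definition posdef (N : nat) (Q : form) : Prop :=
  forall x y : int, (x, y) != (0, 0) ->
    0 < qf_eval (coefa Q) (coefb Q) (N%:Z * coefc Q) x y.

(* Positive definite forms [a, b, N c] of discriminant -m. *)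
Definition forms (N : nat) (m : int) : set form :=
  [set Q | posdef N Q /\ disc N Q = - m].

Definition mx2 (R : Type) (x y z t : R) : 'M[R]_2 :=
  \matrix_(i < 2, j < 2)
    if i == 0 then (if j == 0 then x else y) else (if j == 0 then z else t).

Definition lambda (N : nat) (Q : form) : 'M[rat]_2 :=
  mx2 ((coefb Q)%:~R / (2 * N%:R)) (- ((coefa Q)%:~R / N%:R))
      (coefc Q)%:~R (- ((coefb Q)%:~R / (2 * N%:R))).

Definition Gamma0 (N : nat) : set 'M[int]_2 :=
  [set g : 'M[int]_2 | \det g = 1 /\ (N%:Z %| (g 1 0)%R)%Z].

(* The quotient of Gamma0 N by {I, -I}, as a set of cosets {g, -g}. *)
Definition PGamma0 (N : nat) : set (set 'M[int]_2) :=
  [set [set g; - g] | g in Gamma0 N].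

Definition conj_mx (g : 'M[int]_2) (L : 'M[rat]_2) : 'M[rat]_2 :=
  let G := map_mx (fun z : int => z%:~R : rat) g in G *m L *m invmx G.

(* -I acts trivially, so these are also the orbits of the quotient. *)
Definition orbit_of (N : nat) (Q : form) : set form :=
  [set Q' | exists2 g, Gamma0 N g & lambda N Q' = conj_mx g (lambda N Q)].

Definition orbits (N : nat) (m : int) : set (set form) :=
  [set orbit_of N Q | Q in forms N m].

Definition stabilizer (N : nat) (Q : form) : set (set 'M[int]_2) :=
  [set C | PGamma0 N C /\ forall g, C g -> conj_mx g (lambda N Q) = lambda N Q].

(* Integers prime to D represented by some [N1 a, b, N2 c] with N1 N2 = N. *)
Definition genus_values (D : int) (N : nat) (Q : form) : set int :=
  [set nu | coprimez nu D /\
     exists N1 N2 : nat, [/\ (0 < N1)%N, (0 < N2)%N, (N1 * N2)%N = N &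
       exists x y : int,
         nu = qf_eval (N1%:Z * coefa Q) (coefb Q) (N2%:Z * coefc Q) x y]].

(* Any element of genus_values may be used; xget picks one. *)
Definition genus_char (D : int) (N : nat) (Q : form) : int :=
  if `[< [/\ (D %| disc N Q)%Z,
             square_mod (disc N Q %/ D)%Z (4 * N%:Z) &
             gcdz (gcdz (gcdz (coefa Q) (coefb Q)) (coefc Q)) D = 1] >]
  then kronecker D (xget 0 (genus_values D N Q)) else 0.

(* The summand is constant on orbits, so it is evaluated at a representative
   chosen by xget. *)
Definition twisted_class_number (N : nat) (D d : int) : rat :=
  \sum_(O \in orbits N (d * D))
    let Q : form := xget (0, 0, 0) O in
    (genus_char D N Q)%:~R / (#|` fset_set (stabilizer N Q)|)%:R : rat.

Definition eqmod_rat (p : nat) (x y : rat) : Prop :=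
  exists k : int, x - y = p%:R * k%:~R.

(* Main.v *)
Require Import Defs.
From mathcomp Require Import cyclic finfield.
From mathcomp Require Import zify ring.
Set Implicit Arguments.
Unset Strict Implicit.
Unset Printing Implicit Defensive.
Local Open Scope ring_scope.

(** Let chi be the genus character of D and S(d) the sum of chi over the
    Gamma0(N)-classes of forms of discriminant -dD.  The three congruences are
    the reduction modulo p of the Hecke relation at p for the constant
    function 1,
      (p + 1) S(d) = S(d p^2) + (-d/p) S(d) + p S(d / p^2),
    once it is known that every class counts with weight one.

    Weights.  A form whose stabilizer is larger than {I, -I} is f times a
    primitive form of discriminant -3 or -4, so its discriminant is -3 f^2 or
    -4 f^2.  If chi does not vanish on it, then f is prime to D, hence D divides
    3 or 4, which no fundamental discriminant D > 1 does (stabilizer_trivial).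
    So the class number is the integer S(d), and Gamma0(N) / {I, -I} acts freely
    on the forms that matter.  The number of classes is finite by reduction
    theory (finite_orbits), which makes the sum over orbits a genuine sum.

    The Hecke relation.  The matrices of determinant p fall into p + 1 classes
    under Gamma0(N), one for each line of the plane over F_p.  Because the action
    is free, the lines that carry Q to the class of Q' are as many as the lines
    that carry Q' to the class of p^2 Q (hecke_correspondence_sym, by adjugates).
    Counting the pairs in the two ways gives
      (p + 1) S(d) = sum over the classes Q' of discriminant -d p^2 D of
                     chi(Q') u(Q'),
    where u(Q') is the number of lines that make Q' divisible by p^2
    (hecke_sum).  If p does not divide Q', its reduction modulo p has one
    double zero and u(Q') = 1; if Q' = p Q, then u(Q') is the number of zeros of
    Q on the projective line over F_p, which is 1 + (-dD/p) modulo p.  As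
    chi(p Q) = (D/p) chi(Q) and (D/p)^2 = 1, the multiples of p contribute
    (-d/p) S(d) beyond S(d p^2).

    The genus character.  All this uses chi(Q o g) = chi(Q) for g of determinant
    1 or p, hence that (D/nu) is the same for all values nu prime to D
    (genus_values_const).  For two values of one form F the product nu nu' is
    (B^2 - disc(F) w^2) / 4, and (D/n) = 1 for such n is a consequence of
    quadratic reciprocity for the Jacobi symbol; a value of [a, b, Nc] and a value
    of [Na, b, c] give the same identity for N nu nu', and the factor N is removed
    with the hypothesis that D is a square modulo N.  Reciprocity comes from
    quadratic Gauss sums in a finite field of characteristic l that contains a
    q-th root of unity. *)

(** * Quadratic characters of finite fields and Gauss sums *)

(** The non-zero elements are #|F|.-1 roots of 'X^(#|F|.-1) - 1, so one of
    them is primitive; its powers give the other orders. *)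
Lemma finField_prim_root (F : finFieldType) (n : nat) :
  (n %| #|F|.-1)%N -> exists w : F, n.-primitive_root w.
Proof.
move=> dvn; have F1 := finNzRing_gt1 F.
have m_gt0 : (0 < #|F|.-1)%N by rewrite -ltnS prednK // ltnW.
suff [w Pw] : exists w : F, (#|F|.-1).-primitive_root w.
  by exists (w ^+ (#|F|.-1 %/ n)); apply: dvdn_prim_root.
have /hasP[w _ Pw] : has (#|F|.-1).-primitive_root [seq x <- enum F | x != 0].
  apply: has_prim_root => //; last 1 first.
  - rewrite -(cardC1 (0 : F)) -(size_image id) /image_mem map_id /enum_mem -filter_predI.
    by rewrite leq_eqVlt; apply/orP; left; apply/eqP; congr size; apply: eq_filter => x; rewrite !inE /= andbT.
  - apply/allP=> x; rewrite mem_filter => /andP[x0 _]; apply/unity_rootP.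
    apply: (mulfI x0); rewrite mulr1 -exprS prednK ?expf_card //; exact: ltnW.
  by rewrite filter_uniq // enum_uniq.
by exists w.
Qed.

Definition legendre (F : finFieldType) (x : F) : int :=
  if x == 0 then 0 else if [exists y, y ^+ 2 == x] then 1 else -1.

Lemma legendre_cases (F : finFieldType) (x : F) : legendre x \in [:: 0; 1; -1 : int].
Proof. by rewrite /legendre; case: ifP => // _; case: ifP. Qed.

(** Symbols are compared through their images in fields of odd characteristic,
    where the Euler criterion and the Gauss sums live. *)
Lemma sign_intr_inj (R : idomainType) (u v : int) : (2 : R) != 0 ->
  u \in [:: 0; 1; -1 : int] -> v \in [:: 0; 1; -1 : int] ->
  u%:~R = v%:~R :> R -> u = v.
Proof.
move=> two0; have one0 := oner_neq0 R.
have N11 : (1 : R) != -1 by rewrite -subr_eq0 opprK.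
rewrite !inE => /or3P[] /eqP-> /or3P[] /eqP-> //; rewrite ?rmorphN ?rmorph1 ?rmorph0 => /eqP.
- by rewrite eq_sym (negbTE one0).
- by rewrite eq_sym oppr_eq0 (negbTE one0).
- by rewrite (negbTE one0).
- by rewrite (negbTE N11).
- by rewrite oppr_eq0 (negbTE one0).
- by rewrite eq_sym (negbTE N11).
Qed.

Lemma odd_card_half (F : finFieldType) : odd #|F| ->
  (0 < (#|F|.-1)./2)%N /\ #|F|.-1 = ((#|F|.-1)./2 * 2)%N.
Proof.
move: (finNzRing_gt1 F); move: #|F| => n n1 on; split; first by lia.
by rewrite muln2 -[LHS]odd_double_half; have -> : odd n.-1 = false by lia.
Qed.

(** Euler's criterion: on powers of a generator w both sides are decided by
    the parity of the exponent, because w ^+ (#|F|.-1)./2 = -1. *)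
Lemma legendre_euler (F : finFieldType) (x : F) : odd #|F| ->
  (legendre x)%:~R = x ^+ (#|F|.-1)./2.
Proof.
move=> oddF; have F1 := finNzRing_gt1 F.
have [m0 Em] := odd_card_half oddF; set m := (_./2) in m0 Em *.
rewrite /legendre; case: eqP => [->|/eqP x0]; first by rewrite expr0n (gtn_eqF m0).
have [w Pw] := @finField_prim_root F _ (dvdnn _).
have unit1 (y : F) : y != 0 -> y ^+ #|F|.-1 = 1.
  move=> y0; apply: (mulfI y0); rewrite mulr1 -exprS prednK ?expf_card //; exact: ltnW.
have wm : w ^+ m = -1.
  have /eqP : (w ^+ m) ^+ 2 = 1 by rewrite -exprM -Em (prim_expr_order Pw).
  rewrite sqrf_eq1 => /orP[|/eqP//]; rewrite -(prim_order_dvd Pw) Em.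
  by move=> /dvdn_leq; lia.
have w0 : w != 0 by rewrite (prim_root_eq0 Pw) Em; lia.
have [i Ei] : exists i : nat, x = w ^+ i.
  have /(prim_rootP Pw)[i ->] := unit1 _ x0; by exists i.
have -> : [exists y, y ^+ 2 == x] = ~~ odd i.
  apply/existsP/idP => [[y /eqP Ey]|Hi]; last first.
    by exists (w ^+ i./2); rewrite -exprM muln2 halfK (negbTE Hi) subn0 Ei.
  have y0 : y != 0 by apply: contraNneq x0 => y0; rewrite -Ey y0 expr0n.
  have [j Ej] : exists j : nat, y = w ^+ j.
    by have /(prim_rootP Pw)[j ->] := unit1 _ y0; exists j.
  have : w ^+ (j * 2) == w ^+ i by rewrite -Ei -Ey Ej -exprM.
  rewrite (eq_prim_root_expr Pw) => /eqP /(congr1 odd).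
  by rewrite Em !odd_mod ?oddM ?andbF // => <-.
rewrite Ei -exprM mulnC exprM wm -signr_odd.
by case: (odd i).
Qed.

Lemma legendreM (F : finFieldType) (x y : F) : odd #|F| -> legendre (x * y) = legendre x * legendre y.
Proof.
move=> oddF; have two0 : (2 : F) != 0.
  have [w Pw] := @finField_prim_root F _ (dvdnn _).
  apply/eqP => two0.
  have [m0 Em] := odd_card_half oddF; set m := (_./2) in m0 Em *.
  have /eqP : (w ^+ m) ^+ 2 = 1 by rewrite -exprM -Em (prim_expr_order Pw).
  rewrite sqrf_eq1 => /orP[|/eqP H].
    by rewrite -(prim_order_dvd Pw) Em => /dvdn_leq; lia.
  have : w ^+ m == 1.
    by rewrite H -subr_eq0 -opprD oppr_eq0; apply/eqP.
  by rewrite -(prim_order_dvd Pw) Em => /dvdn_leq; lia.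
apply: (sign_intr_inj two0); rewrite ?legendre_cases //.
  by have := legendre_cases x; have := legendre_cases y; rewrite !inE => /or3P[]/eqP-> /or3P[]/eqP->.
by rewrite intrM !legendre_euler // exprMn.
Qed.

Lemma legendre_mulxx (F : finFieldType) (x : F) : x != 0 -> legendre x * legendre x = 1.
Proof. by rewrite /legendre => /negbTE->; case: ifP. Qed.

Lemma exists_nonresidue (F : finFieldType) : odd #|F| -> exists w : F, legendre w = -1.
Proof.
move=> oddF; have [m0 Em] := odd_card_half oddF; set m := (_./2) in m0 Em *.
have [w Pw] := @finField_prim_root F _ (dvdnn _).
exists w; have w0 : w != 0 by rewrite (prim_root_eq0 Pw) Em; lia.
have := legendre_euler w oddF; rewrite /legendre (negbTE w0); case: ifP => // _ /esym/eqP.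
by rewrite -(prim_order_dvd Pw) Em => /dvdn_leq; lia.
Qed.

Lemma sum_legendre (F : finFieldType) : odd #|F| -> \sum_(x : F) legendre x = 0.
Proof.
move=> oddF; have [w Hw] := exists_nonresidue oddF.
have w0 : w != 0 by apply: contra_eqN Hw => /eqP->; rewrite /legendre eqxx.
have : \sum_(x : F) legendre x = - \sum_(x : F) legendre x.
  rewrite {1}(reindex_inj (mulfI w0)) /= -sumrN; apply: eq_bigr => x _.
  by rewrite legendreM // Hw mulN1r.
by lia.
Qed.

Section Gauss.
Variables (q : nat) (L : fieldType) (z : L).
Hypotheses (pq : prime q) (oq : odd q) (Pz : q.-primitive_root z).

Let e (x : 'F_q) : L := z ^+ x.
Let cF : #|'F_q| = q := card_Fp pq.

(** x |-> z ^+ x is the additive character of F_q attached to z. *)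
Lemma add_charD x y : e (x + y) = e x * e y.
Proof.
rewrite /e -exprD -[RHS](prim_expr_mod Pz) /=.
by congr (_ ^+ (_ %% _)); rewrite Fp_cast.
Qed.

Lemma sum_add_char (c : 'F_q) : \sum_x e (x * c) = if c == 0 then q%:R else 0.
Proof.
case: eqP => [->|/eqP c0].
  under eq_bigr do rewrite mulr0 /e expr0.
  by rewrite sumr_const cF.
have -> : \sum_x e (x * c) = \sum_x e x by rewrite [RHS](reindex_inj (mulIf c0)).
pose S := \sum_x e x; have : e 1 * S = S.
  rewrite /S mulr_sumr [RHS](reindex_inj (addrI 1)) /=.
  by apply: eq_bigr => x _; rewrite add_charD.
move/eqP; rewrite -subr_eq0 -{2}[S]mul1r -mulrBl mulf_eq0 => /orP[|/eqP//].
rewrite subr_eq0 /e -(prim_order_dvd Pz).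
have -> : nat_of_ord (1 : 'F_q) = 1%N by rewrite /= Fp_cast // modn_small ?prime_gt1.
by rewrite dvdn1 => /eqP q1; move: pq; rewrite q1.
Qed.

Definition gauss_sum := \sum_x (legendre x)%:~R * e x.

(** Substituting y = x c in the double sum turns the product of the characters
    into legendre c times the additive character of x (1 + c), and the sum
    over x selects c = -1. *)
Lemma gauss_sum_sqr : gauss_sum ^+ 2 = (legendre (-1 : 'F_q) * q%:Z)%:~R.
Proof.
have oF : odd #|'F_q| by rewrite cF.
rewrite expr2 {1}/gauss_sum mulr_suml.
under eq_bigr => x _ do rewrite /gauss_sum mulr_sumr.
have step x : x != 0 ->
    \sum_y (legendre x)%:~R * e x * ((legendre y)%:~R * e y) = \sum_c (legendre c)%:~R * e (x * (1 + c)).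
  move=> x0; rewrite (reindex_inj (mulfI x0)) /=; apply: eq_bigr => c _.
  rewrite mulrDr mulr1 add_charD mulrACA -intrM legendreM // mulrA.
  by rewrite (mulrA (legendre x)) legendre_mulxx // mul1r mulrA.
rewrite (bigD1 0) //= big1 ?add0r; last first.
  by move=> y _; rewrite /legendre eqxx !mul0r.
rewrite (eq_bigr _ step) exchange_big /=.
under eq_bigr => c _ do rewrite -mulr_sumr.
have step2 c : \sum_(x | x != 0) e (x * (1 + c)) = (if c == -1 then q%:R else 0) - 1.
  have -> : (c == -1) = (1 + c == 0) by rewrite addrC addr_eq0.
  by rewrite -sum_add_char [in RHS](bigD1 0) //= mul0r /e expr0 addrAC subrr add0r.
under eq_bigr => c _ do rewrite step2 mulrBr mulr1.
rewrite sumrB -rmorph_sum sum_legendre // rmorph0 subr0 (bigD1 (-1)) //= eqxx big1 ?addr0.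
  by rewrite rmorphM.
by move=> c /negbTE->; rewrite mulr0.
Qed.

(** The Frobenius of L is additive, fixes the values of legendre, and replaces
    x by l x in the additive character. *)
Lemma gauss_sum_frobenius (l : nat) : l \in [pchar L] -> (odd l) -> ~~ (q %| l)%N ->
  gauss_sum ^+ l = (legendre (l%:R : 'F_q))%:~R * gauss_sum.
Proof.
move=> pl ol ql; have oF : odd #|'F_q| by rewrite cF.
have l0 : (l%:R : 'F_q) != 0.
  apply: contraNneq ql => H; rewrite (dvdn_pcharf (pchar_Fp pq)); exact/eqP.
rewrite -(pFrobenius_autE pl) /gauss_sum rmorph_sum [in RHS]mulr_sumr.
rewrite [RHS](reindex_inj (mulfI l0)) /=; apply: eq_bigr => x _.
rewrite rmorphM /= rmorph_int legendreM // mulrA; congr (_ * _).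
  rewrite intrM mulrA -intrM.
  by rewrite legendre_mulxx // mul1r.
rewrite pFrobenius_autE /e -exprM mulnC.
apply/eqP; rewrite (eq_prim_root_expr Pz) -mulr_natl mulr1.
have -> : nat_of_ord (l%:R * x) = ((l * x) %% q)%N.
  by rewrite -[X in _ * X]natr_Zp -natrM val_Fp_nat.
by rewrite modn_mod.
Qed.
End Gauss.

(** * Quadratic reciprocity for primes *)

Lemma intr_eq0_Fp (q : nat) (a : int) : prime q -> (a%:~R == 0 :> 'F_q) = (q%:Z %| a)%Z.
Proof. by move=> pq; rewrite (dvdz_pcharf (pchar_Fp pq)). Qed.

Lemma kronecker_primeE (a : int) (q : nat) : prime q -> odd q ->
  kronecker_prime a q = legendre (a%:~R : 'F_q).
Proof.
move=> pq oq; rewrite /kronecker_prime /legendre intr_eq0_Fp //; case: ifP => // _.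
have -> : (q == 2%N) = false by apply: contraTF oq => /eqP->.
congr (if _ then _ else _); apply/asboolP/existsP => [[x /eqP Hx]|[y /eqP Hy]].
  exists x%:~R; rewrite -subr_eq0 -rmorphXn -rmorphB /= intr_eq0_Fp //.
  by rewrite -eqz_mod_dvd.
exists (y : nat)%:Z; apply/eqP; rewrite eqz_mod_dvd -intr_eq0_Fp // rmorphB rmorphXn /=.
by rewrite -pmulrn natr_Zp Hy subrr.
Qed.

Lemma odd_pchar_two_neq0 (R : nzRingType) (l : nat) : l \in [pchar R] -> odd l -> (2 : R) != 0.
Proof.
move=> pl ol; rewrite -(dvdn_pcharf pl) dvdn_prime2 ?(pcharf_prime pl) //.
by apply: contraTN ol => /eqP->.
Qed.

(** Stated in any field of characteristic l, so that it can be compared with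
    powers of a Gauss sum. *)
Lemma kronecker_prime_euler (R : fieldType) (l : nat) (a : int) : l \in [pchar R] -> odd l ->
  (kronecker_prime a l)%:~R = a%:~R ^+ (l.-1)./2 :> R.
Proof.
move=> pl ol; have prl := pcharf_prime pl.
apply/eqP; rewrite -subr_eq0 -rmorphXn -rmorphB /= -(dvdz_pcharf pl).
rewrite -intr_eq0_Fp // rmorphB rmorphXn /= kronecker_primeE // legendre_euler ?card_Fp //.
by rewrite subrr.
Qed.

(** For odd q this is the integer q^* = q or -q that is 1 modulo 4. *)
Definition star (q : int) : int := if (q %% 4)%Z == 1 then q else - q.

Lemma kronecker_prime_cases a q : kronecker_prime a q \in [:: 0; 1; -1 : int].
Proof. by rewrite /kronecker_prime; do !case: ifP => //. Qed.

Lemma Fp2_neq0 q : prime q -> odd q -> (2 : 'F_q) != 0.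
Proof. by move=> pq; apply: odd_pchar_two_neq0 (pchar_Fp pq). Qed.

Lemma kronecker_prime_N1 (q : nat) : prime q -> odd q ->
  kronecker_prime (-1) q = if (q %% 4 == 1)%N then 1 else -1.
Proof.
move=> pq oq; apply: (sign_intr_inj (Fp2_neq0 pq oq)); rewrite ?kronecker_prime_cases //; first by case: ifP.
rewrite (kronecker_prime_euler _ (pchar_Fp pq)) // rmorphN rmorph1 -signr_odd.
have -> : odd (q.-1)./2 = ~~ (q %% 4 == 1)%N by lia.
by case: ifP.
Qed.

Lemma legendreN1_mul (q : nat) : prime q -> odd q -> legendre (-1 : 'F_q) * q%:Z = star q.
Proof.
move=> pq oq; have := kronecker_prime_N1 pq oq; rewrite kronecker_primeE // rmorphN rmorph1 => ->.
rewrite /star; have -> : ((q%:Z %% 4)%Z == 1) = (q %% 4 == 1)%N by lia.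
by case: ifP; rewrite ?mul1r ?mulN1r.
Qed.

Lemma field_with_prim_root (l n : nat) (k : nat) : prime l -> (0 < k)%N -> (n %| (l ^ k).-1)%N ->
  exists (L : fieldType) (z : L), l \in [pchar L] /\ n.-primitive_root z.
Proof.
move=> pl k0 dvn; have [L charL cardL] := pPrimePowerField pl k0.
have [|z Pz] := @finField_prim_root L n; first by rewrite cardL.
by exists L, z.
Qed.

(** The l-th power of the Gauss sum g is (l/q) g by Frobenius, and
    (g^2)^((l-1)/2) g = (q^*/l) g by Euler's criterion. The field with l^(q-1)
    elements contains a q-th root of unity by Fermat's little theorem. *)
Lemma quadratic_reciprocity (q l : nat) : prime q -> odd q -> prime l -> odd l -> q != l ->
  kronecker_prime (star q) l = kronecker_prime l%:Z q.
Proof.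
move=> pq oq pl ol ql.
have nql : ~~ (q %| l)%N by rewrite dvdn_prime2.
have [||L [z [charL Pz]]] := @field_with_prim_root l q q.-1 pl.
- by have := prime_gt1 pq; lia.
- have cop : coprime l q by rewrite coprime_sym prime_coprime.
  have := Euler_exp_totient cop; rewrite totient_prime // => /eqP.
  by rewrite eqn_mod_dvd ?expn_gt0 ?prime_gt0 // subn1.
have two0 := odd_pchar_two_neq0 charL ol.
apply: (sign_intr_inj two0); rewrite ?kronecker_prime_cases //.
rewrite (kronecker_prime_euler _ charL) // -legendreN1_mul // -(gauss_sum_sqr pq oq Pz).
have fr := gauss_sum_frobenius pq oq Pz charL ol nql.
have g0 : gauss_sum q z != 0.
  have : gauss_sum q z ^+ 2 != 0.
    rewrite (gauss_sum_sqr pq oq Pz) legendreN1_mul // -(dvdz_pcharf charL) /star.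
    have lq : ~~ (l %| q)%N by rewrite dvdn_prime2 // eq_sym.
    by case: ifP => _; rewrite dvdzE ?abszN.
  by apply: contraNneq => ->; rewrite expr0n.
apply: (mulIf g0); rewrite kronecker_primeE // -fr -exprM.
have -> : (2 * l.-1./2)%N = l.-1 by move: ol; clear; lia.
by rewrite -exprSr prednK ?prime_gt0.
Qed.

(** The same argument with t = z + z^-1 in place of the Gauss sum, z being a
    primitive 8th root of unity in the field with q^2 elements: t^2 = 2, and
    the q-th power of t is t or -t according to q modulo 8. *)
Lemma kronecker_prime_2 (q : nat) : prime q -> odd q ->
  kronecker_prime 2 q = if (q %% 8 == 1)%N || (q %% 8 == 7)%N then 1 else -1.
Proof.
move=> pq oq.
have [|L [z [charL Pz]]] := @field_with_prim_root q 8 2 pq isT.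
  have : ((q ^ 2) %% 8 = 1)%N.
    have : (q %% 8 \in [:: 1; 3; 5; 7])%N by rewrite !inE; move: oq; clear; lia.
    by rewrite -modnXm !inE => /or4P[]/eqP->.
  by move: (q ^ 2)%N => n; lia.
have two0 := odd_pchar_two_neq0 charL oq.
apply: (sign_intr_inj two0); rewrite ?kronecker_prime_cases //; first by case: ifP.
have z0 : z != 0 by rewrite (prim_root_eq0 Pz).
have z4 : z ^+ 4 = -1.
  have /eqP : (z ^+ 4) ^+ 2 = 1 by rewrite -exprM (prim_expr_order Pz).
  by rewrite sqrf_eq1 -(prim_order_dvd Pz) /= => /eqP.
have z8 := prim_expr_order Pz.
(* z ^+ 7 is the inverse of z *)
pose t := z + z ^+ 7.
have t2 : t ^+ 2 = 2.
  have -> : t ^+ 2 = z ^+ 2 + 2 * (z ^+ 4) ^+ 2 + (z ^+ 4) ^+ 3 * z ^+ 2 by rewrite /t; ring.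
  by rewrite z4; ring.
have t0 : t != 0 by apply: contraNneq two0 => H; rewrite -t2 H expr0n.
apply: (mulIf t0).
rewrite (kronecker_prime_euler _ charL) // -[2%:~R]/2%:R -t2 -exprM.
have -> : (2 * q.-1./2)%N = q.-1 by move: oq; clear; lia.
rewrite -exprSr prednK ?prime_gt0 //.
rewrite -(pFrobenius_autE charL) /t rmorphD rmorphXn /= pFrobenius_autE.
rewrite -exprM -(prim_expr_mod Pz q) -(prim_expr_mod Pz (q * 7)).
have : (q %% 8 \in [:: 1; 3; 5; 7])%N by rewrite !inE; move: oq; clear; lia.
have E5 : z ^+ 5 = - z by rewrite (exprD _ 4 1) z4 mulN1r.
have E3 : z ^+ 3 = - z ^+ 7 by rewrite (exprD _ 4 3) z4 mulN1r opprK.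
rewrite !inE -modnMml => /or4P[]/eqP->; rewrite /= ?mul1r //.
- by rewrite -[(_ %% _)%N]/5%N E5 E3 rmorphN1 mulN1r opprD addrC.
- by rewrite -[(_ %% _)%N]/3%N E5 E3 rmorphN1 mulN1r opprD.
- by rewrite -[(_ %% _)%N]/1%N addrC.
Qed.

Lemma kronecker_primeM a b q : prime q -> kronecker_prime (a * b) q = kronecker_prime a q * kronecker_prime b q.
Proof.
move=> pq; have [oq|/negbTE eq] := boolP (odd q).
  by rewrite !kronecker_primeE // intrM legendreM // card_Fp.
have q2 : q = 2%N by apply/eqP; move: eq; case/even_prime: pq => [->|->].
have key (c : int) : kronecker_prime c 2 =
    let r := (c %% 8)%Z in if (r == 1) || (r == 7) then 1 else if (r == 3) || (r == 5) then -1 else 0.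
  rewrite /kronecker_prime /=; have -> : (2%:Z %| c)%Z = ((c %% 8)%Z \in [:: 0; 2; 4; 6]).
    by rewrite !inE; lia.
  have := @ltz_pmod c 8 isT; have := @modz_ge0 c 8 isT.
  case: (c %% 8)%Z => // n _; by do 8![case: n => [|n] //].
rewrite q2 !key -modzMm.
have := @ltz_pmod a 8 isT; have := @modz_ge0 a 8 isT.
have := @ltz_pmod b 8 isT; have := @modz_ge0 b 8 isT.
case: (a %% 8)%Z => // n; case: (b %% 8)%Z => // m _ + _.
by case: n => [|[|[|[|[|[|[|[|n]]]]]]]] //; case: m => [|[|[|[|[|[|[|[|m]]]]]]]].
Qed.

(** * The Jacobi symbol and its reciprocity law *)

(** The Kronecker symbol at a positive natural number, without the sign
    conventions. *)
Definition jacobi (a : int) (n : nat) : int :=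
  \prod_(qe <- prime_decomp n) kronecker_prime a qe.1 ^+ qe.2.

Lemma kronecker_jacobi (a : int) (n : nat) : (0 < n)%N -> kronecker a n%:Z = jacobi a n.
Proof. by case: n => // n _; rewrite /kronecker /= mul1r. Qed.

(** With a range that does not depend on n, multiplicativity in n is that of
    the exponents logn p n. *)
Lemma jacobi_prod_below (k : nat) (a : int) (n : nat) : (n < k)%N -> (0 < n)%N ->
  jacobi a n = \prod_(0 <= p < k | prime p) kronecker_prime a p ^+ logn p n.
Proof.
move=> nk n0; rewrite /jacobi prime_decompE big_map /=.
rewrite (bigID (mem (primes n)) prime) /= [X in _ * X]big1 ?mulr1; last first.
  move=> p /andP[pp]; rewrite mem_primes pp n0 /= => npn.
  by rewrite lognE pp n0 (negbTE npn) expr0.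
rewrite -[RHS]big_filter; apply: perm_big; apply: uniq_perm.
- exact: primes_uniq.
- by rewrite filter_uniq // iota_uniq.
move=> p; rewrite mem_filter mem_index_iota /= andbAC.
case: (boolP (p \in primes n)); rewrite ?andbF // => pn.
have := pn; rewrite mem_primes => /and3P[-> _ /dvdn_leq] /(_ n0) pn'.
by rewrite /= (leq_ltn_trans pn' nk).
Qed.

Lemma jacobiMr a m n : (0 < m)%N -> (0 < n)%N -> jacobi a (m * n) = jacobi a m * jacobi a n.
Proof.
move=> m0 n0; pose k := (m * n).+1.
have mk : (m < k)%N by rewrite ltnS leq_pmulr.
have nk : (n < k)%N by rewrite ltnS leq_pmull.
rewrite (jacobi_prod_below _ (ltnSn _)) ?muln_gt0 ?m0 // (jacobi_prod_below _ mk) // (jacobi_prod_below _ nk) //.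
by rewrite -big_split /=; apply: eq_bigr => p pp; rewrite lognM // exprD.
Qed.

Lemma jacobi1r a : jacobi a 1 = 1.
Proof. by rewrite /jacobi big_nil. Qed.

Lemma jacobi_prime a p : prime p -> jacobi a p = kronecker_prime a p.
Proof. by move=> pp; rewrite /jacobi prime_decompE primes_prime //= big_seq1 /= logn_prime // eqxx expr1. Qed.

(** Statements on multiplicative functions reduce to primes; unlike the prime
    factorization, this form allows hypotheses on n such as oddness inside
    P. *)
Lemma nat_mul_ind (P : nat -> Prop) : P 1%N -> (forall p, prime p -> P p) ->
  (forall a b, (0 < a)%N -> (0 < b)%N -> P a -> P b -> P (a * b)%N) ->
  forall n, (0 < n)%N -> P n.
Proof.
move=> P1 Pp PM n; have [k] := ubnP n; elim: k n => // k IH n nk n0.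
have [n1|n1] := leqP n 1; first by have -> : n = 1%N by lia.
have [p pp /dvdnP[m En]] : exists2 p, prime p & (p %| n)%N.
  by exists (pdiv n); [exact: pdiv_prime | exact: pdiv_dvd].
have p1 := prime_gt1 pp; have p0 := ltnW p1.
have m0 : (0 < m)%N by move: n0; rewrite En; case: (m).
rewrite En; apply: PM => //; last exact: Pp.
by apply: IH => //; rewrite -ltnS (leq_trans _ nk) // ltnS En ltn_Pmulr.
Qed.

Lemma jacobiMl a b n : (0 < n)%N -> jacobi (a * b) n = jacobi a n * jacobi b n.
Proof.
move: n; apply: nat_mul_ind => [|p pp|m n m0 n0 IHm IHn]; first by rewrite !jacobi1r.
  by rewrite !jacobi_prime // kronecker_primeM.
by rewrite !jacobiMr // IHm IHn mulrACA.
Qed.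

Lemma jacobi_cases a n : (0 < n)%N -> jacobi a n \in [:: 0; 1; -1 : int].
Proof.
move: n; apply: nat_mul_ind => [|p pp|m n m0 n0]; first by rewrite jacobi1r.
  by rewrite jacobi_prime // kronecker_prime_cases.
by rewrite jacobiMr // !inE => /or3P[]/eqP-> /or3P[]/eqP->.
Qed.

Lemma kronecker_prime_eq0 a p : (kronecker_prime a p == 0) = (p%:Z %| a)%Z.
Proof. by rewrite /kronecker_prime; case: ifP => // _; do !case: ifP. Qed.

Lemma jacobi_neq0 a n : (0 < n)%N -> coprimez a n -> jacobi a n != 0.
Proof.
move: n; apply: nat_mul_ind => [|p pp|m n m0 n0 IHm IHn].
- by rewrite jacobi1r.
- by rewrite jacobi_prime // kronecker_prime_eq0 coprimez_sym coprimezE /= prime_coprime // dvdzE.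
- by rewrite PoszM coprimezMr jacobiMr // mulf_eq0 negb_or => /andP[/IHm-> /IHn->].
Qed.

Lemma jacobi_mulxx a n : (0 < n)%N -> coprimez a n -> jacobi a n * jacobi a n = 1.
Proof.
by move=> n0 /(jacobi_neq0 n0); have := jacobi_cases a n0; rewrite !inE => /or3P[]/eqP->.
Qed.

Lemma kronecker_prime_mod a b q : prime q -> odd q -> (a = b %[mod q])%Z ->
  kronecker_prime a q = kronecker_prime b q.
Proof.
move=> pq oq ab; rewrite !kronecker_primeE //; congr legendre; apply/eqP.
by rewrite -subr_eq0 -rmorphB /= intr_eq0_Fp // -eqz_mod_dvd; apply/eqP.
Qed.

Lemma jacobi_mod a b n : (0 < n)%N -> odd n -> (a = b %[mod n])%Z -> jacobi a n = jacobi b n.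
Proof.
move: n; apply: (nat_mul_ind (P := fun n => odd n -> (a = b %[mod n])%Z -> _)).
- by rewrite !jacobi1r.
- by move=> p pp op ab; rewrite !jacobi_prime //; apply: kronecker_prime_mod.
move=> m n m0 n0 IHm IHn; rewrite oddM => /andP[om on] /eqP; rewrite eqz_mod_dvd PoszM => ab.
rewrite !jacobiMr // IHm ?IHn //; apply/eqP; rewrite eqz_mod_dvd.
- by apply: dvdz_trans ab; rewrite dvdz_mull.
- by apply: dvdz_trans ab; rewrite dvdz_mulr.
Qed.

Lemma starM a b : ((a %% 2)%Z = 1) -> ((b %% 2)%Z = 1) -> star (a * b) = star a * star b.
Proof.
move=> oa ob; rewrite /star -modzMm.
have [->|->] : (a %% 4)%Z = 1 \/ (a %% 4)%Z = 3 by lia.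
- have [->|->] : (b %% 4)%Z = 1 \/ (b %% 4)%Z = 3 by lia.
    by [].
  by rewrite /= mulrN.
- have [->|->] : (b %% 4)%Z = 1 \/ (b %% 4)%Z = 3 by lia.
    by rewrite /= mulNr.
  by rewrite /= mulrNN.
Qed.

Lemma star_mod4 a : ((a %% 2)%Z = 1) -> (star a %% 4)%Z = 1.
Proof. by move=> oa; rewrite /star; case: eqP => //; lia. Qed.

Lemma kronecker_prime_1 q : kronecker_prime 1 q = (if (q%:Z %| 1)%Z then 0 else 1).
Proof.
rewrite /kronecker_prime; case: ifP => // _; case: eqP => // _.
by case: asboolP => // -[]; exists 1.
Qed.

Lemma jacobi1l n : (0 < n)%N -> jacobi 1 n = 1.
Proof.
move: n; apply: nat_mul_ind => [|p pp|m n m0 n0 IHm IHn]; first by rewrite jacobi1r.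
  by rewrite jacobi_prime // kronecker_prime_1 dvdz1 /=; case: eqP pp => // ->.
by rewrite jacobiMr // IHm IHn.
Qed.

Lemma kronecker_prime_star_2 q : prime q -> odd q -> kronecker_prime (star q) 2 = kronecker_prime 2 q.
Proof.
move=> pq oq; rewrite kronecker_prime_2 // /kronecker_prime eqxx.
have -> : (2%:Z %| star q)%Z = false by rewrite /star; case: ifP; lia.
congr (if _ then _ else _); rewrite /star; case: ifP; lia.
Qed.

(** Both sides are multiplicative in m and in n (star is so on odd integers,
    as it is the representative of n or -n in the class 1 modulo 4), which
    leaves two primes. *)
Lemma jacobi_star_reciprocity m n : (0 < m)%N -> odd m -> (0 < n)%N -> jacobi (star m) n = jacobi n m.
Proof.
move=> m0; move: m m0 n; apply: (nat_mul_ind (P := fun m => forall n, odd m -> (0 < n)%N -> _)).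
- by move=> n _ n0; rewrite jacobi1r -(jacobi1l n0).
- move=> q pq n oq; move: n; apply: nat_mul_ind => [|l pl|m n m0 n0 IHm IHn].
  + by rewrite jacobi1r jacobi1l ?prime_gt0.
  + rewrite !jacobi_prime //; have [ol|/negbTE el] := boolP (odd l).
      have [<-|ql] := eqVneq q l; last exact: quadratic_reciprocity.
      apply/eqP; rewrite eq_sym /kronecker_prime dvdzz; apply/eqP.
      by have -> : (q%:Z %| star q)%Z by rewrite /star; case: ifP; rewrite ?rpredN ?dvdzz.
    have -> : l = 2%N by apply/eqP; move: el; case/even_prime: pl => [->|->].
    exact: kronecker_prime_star_2.
  + by rewrite jacobiMr // IHm IHn PoszM jacobiMl ?prime_gt0.
move=> a b a0 b0 IHa IHb n; rewrite oddM => /andP[oa ob] n0.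
by rewrite PoszM starM ?jacobiMl ?jacobiMr ?IHa ?IHb //; lia.
Qed.

(** No sign appears because D = star `|D| when D is 1 modulo 4, whatever its
    sign. *)
Lemma jacobi_reciprocity (D : int) n : (D %% 4)%Z = 1 -> (0 < n)%N -> jacobi D n = jacobi n `|D|%N.
Proof.
move=> D4 n0; rewrite -jacobi_star_reciprocity //; try lia.
by congr jacobi; rewrite /star; case: eqP; lia.
Qed.

Lemma jacobi_N1 n : (0 < n)%N -> odd n -> jacobi (-1) n = if (n %% 4 == 1)%N then 1 else -1.
Proof.
move: n; apply: (nat_mul_ind (P := fun n => odd n -> _)).
- by rewrite jacobi1r.
- by move=> p pp op; rewrite jacobi_prime // kronecker_prime_N1.
move=> m n m0 n0 IHm IHn; rewrite oddM => /andP[om on].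
rewrite jacobiMr // IHm // IHn // -modnMm.
have [->|->] : (m %% 4)%N = 1%N \/ (m %% 4)%N = 3 by lia.
  by have [->|->] : (n %% 4)%N = 1%N \/ (n %% 4)%N = 3 by lia.
by have [->|->] : (n %% 4)%N = 1%N \/ (n %% 4)%N = 3 by lia.
Qed.

Lemma jacobi_2 n : (0 < n)%N -> odd n ->
  jacobi 2 n = if (n %% 8 == 1)%N || (n %% 8 == 7)%N then 1 else -1.
Proof.
move: n; apply: (nat_mul_ind (P := fun n => odd n -> _)).
- by rewrite jacobi1r.
- by move=> p pp op; rewrite jacobi_prime // kronecker_prime_2.
move=> m n m0 n0 IHm IHn; rewrite oddM => /andP[om on].
rewrite jacobiMr // IHm // IHn // -modnMm.
have : (m %% 8 \in [:: 1; 3; 5; 7])%N by rewrite !inE; lia.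
have : (n %% 8 \in [:: 1; 3; 5; 7])%N by rewrite !inE; lia.
by rewrite !inE => /or4P[]/eqP-> /or4P[]/eqP->.
Qed.

Lemma jacobi_square_mod (n b : int) (m : nat) : (0 < m)%N -> odd m -> coprimez n m ->
  (n = b ^+ 2 %[mod m])%Z -> jacobi n m = 1.
Proof.
move=> m0 om cnm nb; rewrite (jacobi_mod m0 om nb) expr2 jacobiMl // jacobi_mulxx //.
have : coprimez (b ^+ 2) m.
  by rewrite /coprimez -gcdz_modl -nb gcdz_modl.
by rewrite expr2 coprimezMl => /andP[].
Qed.

Lemma jacobi_square_mod_mul (c n b : int) (m : nat) : (0 < m)%N -> odd m -> coprimez n m ->
  coprimez c m -> (m%:Z %| c ^+ 2 * n - b ^+ 2)%Z -> jacobi n m = 1.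
Proof.
move=> m0 om cnm ccm dv; rewrite -(@jacobi_square_mod (c ^+ 2 * n) b m) //.
- by rewrite jacobiMl // expr2 jacobiMl // jacobi_mulxx // mul1r.
- by rewrite expr2 !coprimezMl ccm.
- by apply/eqP; rewrite eqz_mod_dvd.
Qed.

Lemma odd_sqr_mod8 (b : int) : (b %% 2)%Z = 1 -> (b ^+ 2 %% 8)%Z = 1.
Proof.
move=> ob; have : (b %% 8)%Z \in [:: 1; 3; 5; 7 : int] by rewrite !inE; lia.
by rewrite expr2 -modzMm !inE => /or4P[]/eqP->.
Qed.

Lemma sqr_mod2 (b : int) : (b ^+ 2 %% 2)%Z = (b %% 2)%Z.
Proof.
have : (b %% 2)%Z = 0 \/ (b %% 2)%Z = 1 by lia.
by rewrite expr2 -modzMm => -[]->.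
Qed.

Lemma sqr_mod4 (b : int) : (b ^+ 2 %% 4)%Z = 0 \/ (b ^+ 2 %% 4)%Z = 1.
Proof.
rewrite expr2 -modzMm; have : (b %% 4)%Z \in [:: 0; 1; 2; 3 : int] by rewrite !inE; lia.
by rewrite !inE => /or4P[]/eqP->; [left|right|left|right].
Qed.

(** What the property of being a fundamental discriminant says at the prime
    2. *)
Definition discriminant_at2 (D : int) : Prop :=
  (D %% 4)%Z = 1 \/ exists k, D = 4 * k /\ ((k %% 4)%Z = 2 \/ (k %% 4)%Z = 3).

(** n is represented by the norm form of discriminant D m, and D takes the
    value 1 on such n. If D is odd, reciprocity makes (D/n) the symbol
    (n/|D|), and 4 n is the square B^2 modulo D. If D = 4 k, the symbols of
    the odd part of k are treated in the same way, and n modulo 8, which is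
    determined by k, m w^2 modulo 4 and the parity of n, gives the factors
    (-1/n) and (2/n). *)
Lemma jacobi_principal_genus (D B m w : int) (n : nat) : discriminant_at2 D ->
  (0 < n)%N -> coprimez n D ->
  4 * n%:Z = B ^+ 2 - D * m * w ^+ 2 -> ((m %% 4)%Z = 0 \/ (m %% 4)%Z = 1) -> jacobi D n = 1.
Proof.
move=> discrD n0 cop E m4.
have mw4 : ((m * w ^+ 2) %% 4)%Z = 0 \/ ((m * w ^+ 2) %% 4)%Z = 1.
  have := sqr_mod4 w.
  by rewrite -modzMm; case: m4 => -> [] ->; [left|left|left|right].
case: discrD => [D4|[k [Dk k4]]].
  rewrite jacobi_reciprocity //.
  have oD : odd `|D|%N by lia.
  have D0 : (0 < `|D|)%N by lia.
  have c2 : coprimez 2 `|D|%N by rewrite coprimezE /= coprime2n.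
  have c' : coprimez n `|D|%N by move: cop; rewrite !coprimezE.
  apply: (@jacobi_square_mod_mul 2 _ B) => //.
  have -> : 2 ^+ 2 * n%:Z - B ^+ 2 = - (m * w ^+ 2) * D by lia.
  by rewrite dvdzE /= abszM dvdn_mull.
have on : odd n.
  have : coprimez n 2 by move: cop; rewrite Dk (_ : 4 * k = 2 * (2 * k)) ?coprimezMr; [case/andP|ring].
  by rewrite coprimezE /= coprimen2.
have [b Eb] : exists b, B = 2 * b.
  have : (B ^+ 2 %% 2)%Z = 0 by rewrite Dk in E; lia.
  by rewrite sqr_mod2 => ?; exists (B %/ 2)%Z; lia.
set M := m * w ^+ 2 in mw4.
have En : n%:Z = b ^+ 2 - k * M by rewrite Eb Dk in E; rewrite /M; lia.
have cop2 : coprimez 2 n by rewrite coprimezE /= coprime2n.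
have copk : coprimez n k by move: cop; rewrite Dk coprimezMr => /andP[].
have -> : jacobi D n = jacobi k n.
  by rewrite Dk (_ : 4 * k = 2 * 2 * k) // jacobiMl // jacobiMl // jacobi_mulxx // mul1r.
have sq (h : int) : (h %% 2)%Z = 1 -> (h %| k)%Z -> jacobi n `|h| = 1.
  move=> oh hk; apply: (@jacobi_square_mod_mul 1 _ b).
  - by clear -oh; lia.
  - by clear -oh; lia.
  - move: copk; case/dvdzP: hk => k' ->; rewrite coprimezMr => /andP[_].
    by rewrite !coprimezE.
  - by rewrite coprimezE /= coprime1n.
  have -> : 1 ^+ 2 * n%:Z - b ^+ 2 = - M * k by rewrite En; ring.
  by rewrite dvdz_mull //; move: hk; rewrite !dvdzE.
have oddkM (h : int) : (h * M %% 4)%Z = ((h %% 4)%Z * (M %% 4)%Z %% 4)%Z by rewrite modzMm.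
case: k4 => k4; last first.
  rewrite -[k]opprK -mulN1r jacobiMl // [jacobi (- k) n]jacobi_reciprocity //; last by lia.
  rewrite abszN sq ?dvdzz //; last by lia.
  rewrite jacobi_N1 // mulr1; case: eqP => // -[].
  have := oddkM k; have := sqr_mod4 b.
  rewrite k4; move: En on; move: (b ^+ 2) => b2.
  by case: mw4 => ->; move: (k * M) => kM; lia.
have [h Eh] : exists h, k = 2 * h by exists (k %/ 2)%Z; lia.
have oh : (h %% 2)%Z = 1 by lia.
have hk : (h %| k)%Z by rewrite Eh dvdz_mull.
have ob : (b ^+ 2 %% 8)%Z = 1.
  by apply: odd_sqr_mod8; rewrite -sqr_mod2; move: En; rewrite Eh -mulrA; lia.
have n8 : n%:Z = b ^+ 2 - 2 * (h * M) by rewrite En Eh mulrA.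
rewrite Eh jacobiMl // jacobi_2 //.
have [h4|h4] : (h %% 4)%Z = 1 \/ (h %% 4)%Z = 3 by clear -oh; lia.
  rewrite jacobi_reciprocity // sq // mulr1; have := oddkM h; rewrite h4.
  move: n8 ob on mw4; move: (h * M) (b ^+ 2) => P b2; clear.
  by move=> ? ? ? [] -> ?; case: ifP => //; lia.
rewrite -[h]opprK -[- - h]mulN1r jacobiMl // [jacobi (- h) n]jacobi_reciprocity //; last by clear -h4; lia.
rewrite abszN sq // mulr1 jacobi_N1 //; have := oddkM h; rewrite h4.
move: n8 ob on mw4; move: (h * M) (b ^+ 2) => P b2; clear.
by move=> ? ? ? [] -> ?; do 2!case: ifP => //; lia.
Qed.

(** * The action of integral matrices on forms of level N *)

(** (x, y, z, t) stands for the matrix with rows (x, y) and (N z, t); with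
    this encoding membership in Gamma0(N) is only a condition on the
    determinant, and all identities below are polynomial. *)
Definition level_mat : Type := (int * int * int * int)%type.

(** Q o g^T, read on the coefficients a, b, c of [a, b, N c]; on lambda N Q it
    is conjugation by g when g has determinant 1. *)
Definition act (N : nat) (g : level_mat) (Q : form) : form :=
  let: (x, y, z, t) := g in let: (a, b, c) := Q in
  (a * x ^+ 2 + b * x * y + N%:Z * c * y ^+ 2,
   2 * N%:Z * a * x * z + b * (x * t + N%:Z * y * z) + 2 * N%:Z * c * y * t,
   N%:Z * a * z ^+ 2 + b * z * t + c * t ^+ 2).

Definition gmul (N : nat) (g h : level_mat) : level_mat :=
  let: (x, y, z, t) := g in let: (x', y', z', t') := h in
  (x * x' + N%:Z * y * z', x * y' + y * t', z * x' + t * z', N%:Z * z * y' + t * t').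

Definition gdet (N : nat) (g : level_mat) : int :=
  let: (x, y, z, t) := g in x * t - N%:Z * y * z.

(** The adjugate, which plays the role of an inverse also for matrices of
    determinant p. *)
Definition gadj (g : level_mat) : level_mat := let: (x, y, z, t) := g in (t, - y, - z, x).

Definition gscalar (k : int) : level_mat := (k, 0, 0, k).

Definition scale (k : int) (Q : form) : form := let: (a, b, c) := Q in (k * a, k * b, k * c).

Lemma act_mul N g h Q : act N (gmul N g h) Q = act N g (act N h Q).
Proof. by case: g => [[[x y] z] t]; case: h => [[[x' y'] z'] t']; case: Q => [[a b] c] /=; congr (_, _, _); ring. Qed.

Lemma act_gscalar N k Q : act N (gscalar k) Q = scale (k ^+ 2) Q.
Proof. by case: Q => [[a b] c] /=; congr (_, _, _); ring. Qed.

Lemma scale1 Q : scale 1 Q = Q.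
Proof. by case: Q => [[a b] c] /=; rewrite !mul1r. Qed.

Lemma act1 N Q : act N (gscalar 1) Q = Q.
Proof. by rewrite act_gscalar expr1n scale1. Qed.

Lemma act_scale N g k Q : act N g (scale k Q) = scale k (act N g Q).
Proof. by case: g => [[[x y] z] t]; case: Q => [[a b] c] /=; congr (_, _, _); ring. Qed.

Lemma scale_inj k : k != 0 -> injective (scale k).
Proof. by move=> k0 [[a b] c] [[a' b'] c'] /= [/(mulfI k0)-> /(mulfI k0)-> /(mulfI k0)->]. Qed.

Lemma gdet_mul N g h : gdet N (gmul N g h) = gdet N g * gdet N h.
Proof. by case: g => [[[x y] z] t]; case: h => [[[x' y'] z'] t'] /=; ring. Qed.

Lemma gdet_adj N g : gdet N (gadj g) = gdet N g.
Proof. by case: g => [[[x y] z] t] /=; ring. Qed.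

Lemma gadjK g : gadj (gadj g) = g.
Proof. by case: g => [[[x y] z] t] /=; rewrite !opprK. Qed.

Lemma gadj_mul N g h : gadj (gmul N g h) = gmul N (gadj h) (gadj g).
Proof. by case: g => [[[x y] z] t]; case: h => [[[x' y'] z'] t'] /=; congr (_, _, _, _); ring. Qed.

Lemma gmulA N g h k : gmul N g (gmul N h k) = gmul N (gmul N g h) k.
Proof.
case: g => [[[x y] z] t]; case: h => [[[x' y'] z'] t']; case: k => [[[x2 y2] z2] t2] /=.
by congr (_, _, _, _); ring.
Qed.

Lemma gmul_adjl N g : gmul N (gadj g) g = gscalar (gdet N g).
Proof. by case: g => [[[x y] z] t] /=; congr (_, _, _, _); ring. Qed.

Lemma gmul1 N g : gmul N (gscalar 1) g = g.
Proof. by case: g => [[[x y] z] t] /=; congr (_, _, _, _); ring. Qed.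

Lemma act_adjK N g Q : act N (gadj g) (act N g Q) = scale (gdet N g ^+ 2) Q.
Proof. by rewrite -act_mul gmul_adjl act_gscalar. Qed.

Lemma disc_act N g Q : disc N (act N g Q) = gdet N g ^+ 2 * disc N Q.
Proof. by case: g => [[[x y] z] t]; case: Q => [[a b] c]; rewrite /disc /coefa /coefb /coefc /=; ring. Qed.

Lemma disc_scale N k Q : disc N (scale k Q) = k ^+ 2 * disc N Q.
Proof. by case: Q => [[a b] c]; rewrite /disc /coefa /coefb /coefc /=; ring. Qed.

Definition eval_form (N : nat) (Q : form) (x y : int) := qf_eval (coefa Q) (coefb Q) (N%:Z * coefc Q) x y.
(** Values of [N a, b, c], the transform of [a, b, N c] by the Fricke
    involution; for prime N the values of these two forms are all that enters
    the genus character. *)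
Definition eval_fricke (N : nat) (Q : form) (x y : int) := qf_eval (N%:Z * coefa Q) (coefb Q) (coefc Q) x y.

Lemma eval_form_act N x y z t Q X Y :
  eval_form N (act N (x, y, z, t) Q) X Y = eval_form N Q (x * X + N%:Z * z * Y) (y * X + t * Y).
Proof. by case: Q => [[a b] c]; rewrite /eval_form /qf_eval /coefa /coefb /coefc /=; ring. Qed.

Lemma eval_fricke_act N x y z t Q X Y :
  eval_fricke N (act N (x, y, z, t) Q) X Y = eval_fricke N Q (x * X + z * Y) (N%:Z * y * X + t * Y).
Proof. by case: Q => [[a b] c]; rewrite /eval_fricke /qf_eval /coefa /coefb /coefc /=; ring. Qed.

Lemma eval_frickeE N Q x y : N%:Z * eval_fricke N Q x y = eval_form N Q (N%:Z * x) y.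
Proof. by case: Q => [[a b] c]; rewrite /eval_fricke /eval_form /qf_eval /coefa /coefb /coefc /=; ring. Qed.

Lemma eval_form_scale N k Q x y : eval_form N (scale k Q) x y = k * eval_form N Q x y.
Proof. by case: Q => [[a b] c]; rewrite /eval_form /qf_eval /coefa /coefb /coefc /=; ring. Qed.

Lemma eval_fricke_scale N k Q x y : eval_fricke N (scale k Q) x y = k * eval_fricke N Q x y.
Proof. by case: Q => [[a b] c]; rewrite /eval_fricke /qf_eval /coefa /coefb /coefc /=; ring. Qed.

Lemma posdef_act N g Q : gdet N g != 0 -> posdef N Q -> posdef N (act N g Q).
Proof.
case: g => [[[x y] z] t] /= d0 pd X Y XY.
rewrite -/(eval_form N _ X Y) eval_form_act; apply: pd.
apply: contraNneq XY => -[E1 E2].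
have HX : (x * t - N%:Z * y * z) * X = 0.
  transitivity (t * (x * X + N%:Z * z * Y) - N%:Z * z * (y * X + t * Y)); first by ring.
  by rewrite E1 E2 !mulr0 subrr.
have HY : (x * t - N%:Z * y * z) * Y = 0.
  transitivity (x * (y * X + t * Y) - y * (x * X + N%:Z * z * Y)); first by ring.
  by rewrite E1 E2 !mulr0 subrr.
move/eqP: HX; rewrite mulf_eq0 (negbTE d0) /= => /eqP->.
by move/eqP: HY; rewrite mulf_eq0 (negbTE d0) /= => /eqP->.
Qed.

Lemma posdef_scale N k Q : 0 < k -> posdef N (scale k Q) <-> posdef N Q.
Proof.
move=> k0; split=> pd X Y XY; have := pd X Y XY.
  by rewrite -/(eval_form N _ X Y) eval_form_scale pmulr_rgt0.
by rewrite -!/(eval_form N _ X Y) eval_form_scale pmulr_rgt0.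
Qed.

Lemma posdef_a N Q : posdef N Q -> 0 < coefa Q.
Proof. by move/(_ 1 0 isT); rewrite /qf_eval expr1n mulr1 mulr0 expr0n /= mulr0 !addr0. Qed.

(** * Independence of the genus character from the represented value *)

Lemma genus_valuesP D N Q nu : prime N ->
  genus_values D N Q nu <->
  coprimez nu D /\ ((exists x y, nu = eval_form N Q x y) \/ (exists x y, nu = eval_fricke N Q x y)).
Proof.
move=> pN; split=> [[cop [N1 [N2 [_ _ E [x [y Enu]]]]]]|[cop H]]; split=> //.
  have dv1 : (N1 %| N)%N by rewrite -E dvdn_mulr.
  have := (primeP pN).2 _ dv1; case/orP=> /eqP E1.
    left; exists x, y; move: E; rewrite E1 mul1n => E2.
    by rewrite Enu E1 E2 mul1r.
  right; exists x, y; move: E; rewrite E1 -[RHS]muln1 => /eqP.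
  by rewrite eqn_pmul2l ?prime_gt0 // => /eqP E2; rewrite Enu E1 E2 mul1r.
have N0 := prime_gt0 pN; case: H => -[x [y Enu]].
  exists 1%N, N; split=> //; first by rewrite mul1n.
  by exists x, y; rewrite Enu /eval_form mul1r.
exists N, 1%N; split=> //; first by rewrite muln1.
by exists x, y; rewrite Enu /eval_fricke mul1r.
Qed.

Lemma fundamental_discriminant_at2 D : fundamental_discriminant D -> discriminant_at2 D.
Proof.
case=> [[D4 _]|[m [Dm m4 _]]]; first by left.
by right; exists m; split.
Qed.

Lemma fundamental_sqr_ndvd D (q : nat) : fundamental_discriminant D -> prime q -> odd q ->
  ~~ ((q ^ 2)%N%:Z %| D)%Z.
Proof.
move=> fD pq oq; case: fD => [[_ /(_ q pq)]//|[m [-> _ /(_ q pq)]]].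
apply: contra; rewrite !dvdzE abszM Gauss_dvdr // coprimeXl //.
by rewrite (_ : absz 4 = 2 ^ 2)%N // coprimeXr // coprimen2.
Qed.

Lemma eval_form_mul N Q x y x' y' :
  exists B w, 4 * (eval_form N Q x y * eval_form N Q x' y') = B ^+ 2 - disc N Q * w ^+ 2.
Proof.
case: Q => [[a b] c]; rewrite /eval_form /disc /qf_eval /coefa /coefb /coefc /=.
exists (2 * a * x * x' + b * (x * y' + x' * y) + 2 * N%:Z * c * y * y'), (x * y' - x' * y).
by ring.
Qed.

Lemma eval_fricke_mul N Q x y x' y' :
  exists B w, 4 * (eval_fricke N Q x y * eval_fricke N Q x' y') = B ^+ 2 - disc N Q * w ^+ 2.
Proof.
case: Q => [[a b] c]; rewrite /eval_fricke /disc /qf_eval /coefa /coefb /coefc /=.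
exists (2 * N%:Z * a * x * x' + b * (x * y' + x' * y) + 2 * c * y * y'), (x * y' - x' * y).
by ring.
Qed.

Lemma eval_mixed_mul N Q x y x' y' :
  exists B w, 4 * (N%:Z * (eval_form N Q x y * eval_fricke N Q x' y')) = B ^+ 2 - disc N Q * w ^+ 2.
Proof. by have [B [w E]] := eval_form_mul N Q x y (N%:Z * x') y'; exists B, w; rewrite -E -eval_frickeE; ring. Qed.

Lemma square_mod_dvd a m k : (k %| m)%Z -> square_mod a m -> square_mod a k.
Proof.
move=> km [x /eqP]; rewrite eqz_mod_dvd => H; exists x; apply/eqP; rewrite eqz_mod_dvd.
exact: dvdz_trans H.
Qed.

Lemma square_mod_4 a : square_mod a 4 -> (a %% 4)%Z = 0 \/ (a %% 4)%Z = 1.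
Proof. by case=> x <-; apply: sqr_mod4. Qed.

Section GenusChar.
Variables (N : nat) (D m : int) (Q : form).
Hypotheses (pN : prime N) (oN : odd N) (D1 : 1 < D) (fD : fundamental_discriminant D).
Hypotheses (sD : square_mod D (4 * N%:Z)) (sm : square_mod m (4 * N%:Z)).
Hypotheses (pd : posdef N Q) (dQ : disc N Q = D * m).

Lemma genus_values_gt0 nu : genus_values D N Q nu -> 0 < nu.
Proof.
move/(genus_valuesP _ _ _ pN) => [cop H].
have nu0 : nu != 0.
  by apply: contraTneq cop => ->; rewrite /coprimez gcd0z; clear -D1; lia.
case: H => -[x [y E]].
  rewrite E; apply: pd; apply: contraNneq nu0 => -[x0 y0].
  by rewrite E x0 y0 /eval_form /qf_eval; apply/eqP; ring.
have N0 : 0 < N%:Z by have := prime_gt0 pN; clear; lia.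
rewrite -(pmulr_rgt0 _ N0) E eval_frickeE; apply: pd.
apply: contraNneq nu0 => -[/eqP]; rewrite mulf_eq0 (gt_eqF N0) /= => /eqP x0 y0.
by rewrite E x0 y0 /eval_fricke /qf_eval; apply/eqP; ring.
Qed.

Lemma quotient_mod4 : (m %% 4)%Z = 0 \/ (m %% 4)%Z = 1.
Proof. by apply: square_mod_4; apply: square_mod_dvd sm; rewrite dvdz_mulr. Qed.

(** One of the two values comes from [a, b, N c] and the other from [N a, b,
    c], so only N n is represented by the norm form. If N does not divide D,
    then (D/N) = 1 because D is a square modulo N. Otherwise D = N^* D0: the
    argument for D0 gives (D0/N)(D0/n) = 1, while dividing the identity by N
    shows that n is a square times -D', D' the quotient of D by N, modulo N (4
    and m are squares modulo N), so that (N^*/n) = (n/N) = (D0/N). *)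
Lemma genus_values_mixed (n : nat) (B w : int) : (0 < n)%N -> coprimez n D ->
  4 * (N%:Z * n%:Z) = B ^+ 2 - D * m * w ^+ 2 -> jacobi D n = 1.
Proof.
move=> n0 cop E; have N0 := prime_gt0 pN.
have [ND|nND] := boolP (N%:Z %| D)%Z; last first.
  have jN : jacobi D N = 1.
    rewrite jacobi_prime // /kronecker_prime (negbTE nND).
    have -> : (N == 2%N) = false by apply: contraTF oN => /eqP->.
    by case: asboolP => // -[]; apply: square_mod_dvd sD; rewrite dvdz_mull.
  have := @jacobi_principal_genus D B m w (N * n) (fundamental_discriminant_at2 fD).
  rewrite muln_gt0 N0 n0 PoszM => /(_ isT); rewrite coprimezMl cop andbT coprimezE /= prime_coprime //.
  move: nND; rewrite dvdzE => nND /(_ nND E quotient_mod4).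
  by rewrite jacobiMr // jN mul1r.
have oNZ : (N%:Z %% 2)%Z = 1 by clear -oN; lia.
(* the sign with star N = eta * N *)
pose eta : int := if (N %% 4 == 1)%N then 1 else -1.
have Eeta : star N = eta * N%:Z.
  rewrite /star /eta; have -> : ((N%:Z %% 4)%Z == 1) = (N %% 4 == 1)%N by clear; lia.
  by case: ifP; rewrite ?mul1r ?mulN1r.
have eta2 : eta * eta = 1 by rewrite /eta; case: ifP.
have [D0 ED] : exists D0, D = star N * D0.
  by case/dvdzP: ND => k ->; exists (eta * k); rewrite Eeta mulrACA eta2 mul1r mulrC.
have s4 := star_mod4 oNZ.
have discr0 : discriminant_at2 D0.
  case: (fundamental_discriminant_at2 fD) => [D4|[k [Dk k4]]].
    by left; transitivity (D %% 4)%Z; rewrite // ED -modzMm s4 mul1r modz_mod.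
  have : (4 %| D0)%Z.
    have : (4 %| star N * D0)%Z by rewrite -ED Dk dvdz_mulr.
    have Es : star N = 4 * (star N %/ 4)%Z + 1 by rewrite {1}(divz_eq (star N) 4) s4 mulrC.
    have {2}-> : D0 = star N * D0 - 4 * ((star N %/ 4)%Z * D0) by rewrite {1}Es; ring.
    by move=> H; rewrite rpredB // dvdz_mulr.
  case/dvdzP=> k0 Ek0; right; exists k0; split; first by rewrite Ek0 mulrC.
  have -> : (k0 %% 4)%Z = (k %% 4)%Z; last by [].
  have -> : k = star N * k0 by apply: (@mulfI _ 4) => //; rewrite -Dk ED Ek0; ring.
  by rewrite -modzMm s4 mul1r modz_mod.
have copN : coprimez n N by move: cop; case/dvdzP: ND => k ->; rewrite coprimezMr => /andP[].
have cop0 : coprimez n D0 by move: cop; rewrite ED coprimezMr => /andP[].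
have copND0 : coprimez N D0.
  rewrite coprimezE /= prime_coprime // -[(N %| _)%N]/(N%:Z %| D0)%Z.
  apply: contra (fundamental_sqr_ndvd fD pN oN).
  case/dvdzP=> k Ek; apply/dvdzP; exists (eta * k); rewrite ED Eeta Ek.
  have : (N ^ 2)%N%:Z = N%:Z * N%:Z by rewrite -PoszM mulnn.
  by move=> ->; ring.
have m4 := quotient_mod4.
(* the identity for N n, read with D0 in place of D and star N * m in place of m *)
have H0 : jacobi D0 N * jacobi D0 n = 1.
  rewrite -jacobiMr //; apply: (@jacobi_principal_genus D0 B (star N * m) w) => //.
  - by rewrite muln_gt0 N0.
  - by rewrite PoszM coprimezMl copND0.
  - by rewrite PoszM E ED; ring.
  - by rewrite -modzMm s4 mul1r modz_mod.
(* N divides B^2, so the identity can be divided by N *)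
have NB : (N%:Z %| B)%Z.
  have : (N%:Z %| B ^+ 2)%Z.
    have -> : B ^+ 2 = N%:Z * (4 * n%:Z) + D * (m * w ^+ 2) by rewrite mulrA; lia.
    by rewrite rpredD ?dvdz_mulr.
  by rewrite !dvdzE abszX Euclid_dvdX // => /andP[].
case/dvdzP: NB => B1 EB.
have E1 : 4 * n%:Z = N%:Z * B1 ^+ 2 - eta * D0 * m * w ^+ 2.
  have NZ0 : N%:Z != 0 by clear -N0; lia.
  apply: (mulfI NZ0); transitivity (4 * (N%:Z * n%:Z)); first by ring.
  by rewrite E EB ED Eeta; ring.
have [s Es] : square_mod m N by apply: square_mod_dvd sm; rewrite dvdz_mull.
have [k Ek] : exists k, m = s ^+ 2 + k * N%:Z.
  by move/esym/eqP: Es; rewrite eqz_mod_dvd => /dvdzP[k /eqP]; rewrite subr_eq addrC => /eqP->; exists k.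
have jn : jacobi n N = jacobi (- eta * D0) N.
  have c2 : coprimez 2 N by rewrite coprimezE /= coprime2n.
  have -> : jacobi n N = jacobi (2 * 2 * n%:Z) N by rewrite !jacobiMl // jacobi_mulxx // mul1r.
  have Em : (2 * 2 * n%:Z = (s * w) * (s * w) * (- eta * D0) %[mod N])%Z.
    apply/eqP; rewrite eqz_mod_dvd; apply/dvdzP; exists (B1 ^+ 2 - eta * D0 * k * w ^+ 2).
    by rewrite (_ : 2 * 2 * n%:Z = 4 * n%:Z) // E1 Ek; ring.
  have csw : coprimez (s * w) N.
    have : coprimez (2 * 2 * n%:Z) N by rewrite !coprimezMl c2.
    rewrite /coprimez -gcdz_modl Em gcdz_modl -/(coprimez _ _) coprimezMl => /andP[].
    by rewrite coprimezMl => /andP[].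
  rewrite (jacobi_mod N0 oN Em) jacobiMl // jacobiMl // jacobi_mulxx //.
  by rewrite mul1r.
have jeta : jacobi (- eta) N = 1.
  by rewrite /eta; case: ifP => N4; rewrite ?opprK ?jacobi1l // jacobi_N1 // N4.
rewrite ED jacobiMl // jacobi_star_reciprocity // jn jacobiMl // jeta mul1r.
exact: H0.
Qed.

(** The symbols of nu and nu' are signs, so it is enough that the symbol of nu
    nu' is 1. *)
Lemma genus_values_const nu nu' : genus_values D N Q nu -> genus_values D N Q nu' ->
  kronecker D nu = kronecker D nu'.
Proof.
move=> G G'; have := genus_values_gt0 G; have := genus_values_gt0 G'.
move/(genus_valuesP _ _ _ pN): G => [cop H]; move/(genus_valuesP _ _ _ pN): G' => [cop' H'].
case: nu cop H => // n cop H; case: nu' cop' H' => // n' cop' H' n'0 n0.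
have {}n0 : (0 < n)%N by []; have {}n'0 : (0 < n')%N by [].
rewrite !kronecker_jacobi //.
suff J : jacobi D n * jacobi D n' = 1.
  have cn' : coprimez D n' by rewrite coprimez_sym.
  by rewrite -[LHS]mulr1 -(jacobi_mulxx n'0 cn') mulrA J mul1r.
rewrite -jacobiMr //.
have n0n0 : (0 < n * n')%N by rewrite muln_gt0 n0.
have cop2 : coprimez (n * n')%N D by rewrite PoszM coprimezMl cop.
have fin B w : 4 * (n%:Z * n'%:Z) = B ^+ 2 - disc N Q * w ^+ 2 -> jacobi D (n * n') = 1.
  rewrite dQ -PoszM => E; apply: (jacobi_principal_genus (fundamental_discriminant_at2 fD) _ _ E) => //.
  exact: quotient_mod4.
have finN B w : 4 * (N%:Z * (n%:Z * n'%:Z)) = B ^+ 2 - disc N Q * w ^+ 2 -> jacobi D (n * n') = 1.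
  by rewrite dQ -PoszM => E; apply: (genus_values_mixed _ _ E).
case: H H' => -[x [y ->]] [] [x' [y' ->]] in fin finN *.
- by have [B [w E]] := eval_form_mul N Q x y x' y'; apply: fin E.
- by have [B [w E]] := eval_mixed_mul N Q x y x' y'; apply: finN E.
- by have [B [w E]] := eval_mixed_mul N Q x' y' x y; apply: (finN B w); rewrite -E; ring.
- by have [B [w E]] := eval_fricke_mul N Q x y x' y'; apply: fin E.
Qed.
End GenusChar.

(** * Forms on which the genus character is supported *)

Definition form_dvd (k : int) (Q : form) : Prop :=
  [/\ (k %| coefa Q)%Z, (k %| coefb Q)%Z & (k %| coefc Q)%Z].

(** The condition gcd (a, b, c, D) = 1 prime by prime, a formulation that is
    visibly invariant under matrices of determinant prime to D. *)
Definition form_coprime (D : int) (Q : form) : Prop :=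
  forall q : nat, prime q -> (q%:Z %| D)%Z -> ~ form_dvd q%:Z Q.

Lemma form_coprimeP D Q : gcdz (gcdz (gcdz (coefa Q) (coefb Q)) (coefc Q)) D = 1 <-> form_coprime D Q.
Proof.
set G := gcdz _ D; have dvG q : prime q -> (q%:Z %| D)%Z -> form_dvd q%:Z Q -> (q%:Z %| G)%Z.
  by move=> _ qD [qa qb qc]; rewrite !dvdz_gcd qa qb qc.
split=> [G1 q pq qD /(dvG q pq qD)|cop].
  by rewrite G1 dvdz1 /=; case: eqP pq => // ->.
have Gge : 0 <= G by rewrite /G /gcdz.
apply/eqP; apply: contraT => G1.
have [q pq qG] : exists2 q, prime q & (q%:Z %| G)%Z.
  have [/eqP G0|G0] := boolP (G == 0); first by exists 2%N => //; rewrite G0 dvdz0.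
  exists (pdiv `|G|%N); last by rewrite dvdzE /= pdiv_dvd.
  by apply: pdiv_prime; lia.
move: qG; rewrite /G !dvdz_gcd => /andP[/andP[/andP[qa qb] qc] qD].
by case: (cop q pq qD).
Qed.

Lemma form_dvd_act N k g Q : form_dvd k Q -> form_dvd k (act N g Q).
Proof.
case: g => [[[x y] z] t]; case: Q => [[a b] c].
rewrite /form_dvd /coefa /coefb /coefc /= => -[/dvdzP[a' ->] /dvdzP[b' ->] /dvdzP[c' ->]].
split; apply/dvdzP.
- by exists (a' * x ^+ 2 + b' * x * y + N%:Z * c' * y ^+ 2); ring.
- by exists (2 * N%:Z * a' * x * z + b' * (x * t + N%:Z * y * z) + 2 * N%:Z * c' * y * t); ring.
- by exists (N%:Z * a' * z ^+ 2 + b' * z * t + c' * t ^+ 2); ring.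
Qed.

Lemma form_dvd_scale k l Q : form_dvd k Q -> form_dvd k (scale l Q).
Proof. by case: Q => [[a b] c] [/= ka kb kc]; split; rewrite /coefa /coefb /coefc /= dvdz_mull. Qed.

Lemma form_dvd_scaleE k Q : form_dvd k Q <-> exists Q', Q = scale k Q'.
Proof.
case: Q => [[a b] c]; split=> [[/= /dvdzP[a' Ea] /dvdzP[b' Eb] /dvdzP[c' Ec]]|[[[a' b'] c'] /= [-> -> ->]]].
  by exists (a', b', c'); rewrite /= -![k * _]mulrC -Ea -Eb -Ec.
by split; rewrite /coefa /coefb /coefc /= dvdz_mulr.
Qed.

Lemma form_dvd_Gauss q k Q : prime q -> ~~ (q%:Z %| k)%Z -> form_dvd q%:Z (scale k Q) -> form_dvd q%:Z Q.
Proof.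
move=> pq qk; case: Q => [[a b] c]; rewrite /form_dvd /coefa /coefb /coefc /=.
have cop : coprimez q%:Z k by rewrite coprimezE /= prime_coprime // -[(q %| _)%N]/(q%:Z %| k)%Z.
by rewrite !Gauss_dvdzr.
Qed.

Lemma coprimez_ndvd (q : nat) k D : prime q -> (q%:Z %| D)%Z -> coprimez k D -> ~~ (q%:Z %| k)%Z.
Proof.
move=> pq qD cop; apply/negP => qk.
have : (q%:Z %| gcdz k D)%Z by rewrite dvdz_gcd qk.
by rewrite (eqP cop) dvdz1 /=; case: eqP pq => // ->.
Qed.

Lemma form_coprime_act N D g Q : coprimez (gdet N g) D -> form_coprime D Q -> form_coprime D (act N g Q).
Proof.
move=> cop cQ q pq qD /(form_dvd_act N (gadj g)); rewrite act_adjK => dv.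
apply: (cQ q pq qD); apply: form_dvd_Gauss dv => //.
have := coprimez_ndvd pq qD cop; apply: contra.
by rewrite !dvdzE abszX /= Euclid_dvdX // => /andP[].
Qed.

Lemma form_coprime_scale D k Q : coprimez k D -> form_coprime D Q -> form_coprime D (scale k Q).
Proof.
move=> cop cQ q pq qD dv; apply: (cQ q pq qD); apply: form_dvd_Gauss dv => //.
exact: coprimez_ndvd cop.
Qed.

Lemma form_coprime_unscale D k Q : form_coprime D (scale k Q) -> form_coprime D Q.
Proof. by move=> cQ q pq qD dv; apply: (cQ q pq qD); apply: form_dvd_scale. Qed.

(** The forms of discriminant D m on which the genus character can be
    non-zero, when m is a square modulo 4 N. *)
Record admissible (N : nat) (D m : int) (Q : form) : Prop := Admissible {
  admissible_posdef : posdef N Q; admissible_disc : disc N Q = D * m; admissible_coprime : form_coprime D Q }.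

Lemma admissible_act N D m g Q : gdet N g != 0 -> coprimez (gdet N g) D -> admissible N D m Q ->
  admissible N D (m * gdet N g ^+ 2) (act N g Q).
Proof.
move=> g0 cop [pd dQ cQ]; split; first exact: posdef_act.
  by rewrite disc_act dQ; ring.
exact: form_coprime_act.
Qed.

Lemma admissible_scale N D m k Q : 0 < k -> coprimez k D -> admissible N D m Q ->
  admissible N D (m * k ^+ 2) (scale k Q).
Proof.
move=> g0 cop [pd dQ cQ]; split; first exact/posdef_scale.
  by rewrite disc_scale dQ; ring.
exact: form_coprime_scale.
Qed.

Lemma admissible_unscale N D m k Q : 0 < k -> admissible N D (m * k ^+ 2) (scale k Q) -> admissible N D m Q.
Proof.
move=> g0 [pd dQ cQ]; split; first by move/posdef_scale: pd; apply.
  move: dQ; rewrite disc_scale mulrA [LHS]mulrC; apply: mulIf.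
  by rewrite expf_neq0 // gt_eqF.
exact: form_coprime_unscale cQ.
Qed.

(** The value of the form at (b, -2 a) is -a times the discriminant. *)
Lemma disc_lt0 N Q : posdef N Q -> disc N Q < 0.
Proof.
move=> pd; have a0 := posdef_a pd.
have := pd (coefb Q) (- (2 * coefa Q)).
have -> : (coefb Q, - (2 * coefa Q)) != (0, 0).
  by apply/eqP => -[_ /eqP]; rewrite oppr_eq0 mulf_eq0 /= (gt_eqF a0).
have -> : qf_eval (coefa Q) (coefb Q) (N%:Z * coefc Q) (coefb Q) (- (2 * coefa Q)) =
   coefa Q * (- disc N Q) by rewrite /qf_eval /disc; ring.
by rewrite pmulr_rgt0 // oppr_gt0; apply.
Qed.

(** The numbers 2, 3, 4 are not fundamental discriminants. *)
Lemma fundamental_ndvd_3_4 (D e : int) : 1 < D -> fundamental_discriminant D ->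
  (e = 3) \/ (e = 4) -> (D %| e)%Z -> False.
Proof.
move=> D1 fD He De; have HD : D = 2 \/ D = 3 \/ D = 4.
  have : D <= 4 by move: De; rewrite dvdzE => /dvdn_leq; clear -He D1; lia.
  by clear -D1; lia.
by case: fD => [[D4 _]|[m [Dm m4 _]]]; [clear -D4 HD | clear -Dm m4 HD]; lia.
Qed.

Section Chi.
Variables (N : nat) (D : int).
Hypotheses (pN : prime N) (oN : odd N) (D1 : 1 < D) (fD : fundamental_discriminant D).
Hypotheses (sD : square_mod D (4 * N%:Z)).

Lemma genus_char_bad Q : ~ form_coprime D Q -> genus_char D N Q = 0.
Proof. by move=> bad; rewrite /genus_char; case: asboolP => // -[_ _ /form_coprimeP]. Qed.

Lemma genus_char_admissible m Q : square_mod m (4 * N%:Z) -> admissible N D m Q ->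
  genus_char D N Q = kronecker D (xget 0 (genus_values D N Q)).
Proof.
move=> sm [pd dQ /form_coprimeP cQ]; rewrite /genus_char; case: asboolP => // -[]; split => //.
  by rewrite dQ dvdz_mulr.
by rewrite dQ mulrC mulzK // gt_eqF // (lt_trans _ D1).
Qed.

Lemma genus_char_val m Q nu : square_mod m (4 * N%:Z) -> admissible N D m Q ->
  genus_values D N Q nu -> genus_char D N Q = kronecker D nu.
Proof.
move=> sm gQ G; rewrite (genus_char_admissible sm gQ).
have [pd dQ _] := gQ.
apply: (genus_values_const pN oN D1 fD sD sm pd dQ) => //.
by apply: xgetPex; exists nu.
Qed.

Lemma genus_char_empty m Q : square_mod m (4 * N%:Z) -> admissible N D m Q ->
  (forall nu, ~ genus_values D N Q nu) -> genus_char D N Q = 0.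
Proof.
move=> sm gQ G; rewrite (genus_char_admissible sm gQ) xgetPN //.
by rewrite /kronecker eqxx; case: eqP => //; lia.
Qed.

Lemma genus_values_act g Q nu : coprimez (gdet N g) D ->
  genus_values D N (act N g Q) nu -> genus_values D N Q nu.
Proof.
move=> cg /(genus_valuesP _ _ _ pN)[cop H]; apply/(genus_valuesP _ _ _ pN); split=> //.
move: g cg H => [[[x y] z] t] _ [] [X [Y ->]]; [left|right].
  by rewrite eval_form_act; do 2!eexists.
by rewrite eval_fricke_act; do 2!eexists.
Qed.

Lemma genus_values_scale k Q nu : coprimez k D ->
  genus_values D N Q nu -> genus_values D N (scale k Q) (k * nu).
Proof.
move=> ck /(genus_valuesP _ _ _ pN)[cop H]; apply/(genus_valuesP _ _ _ pN).
rewrite coprimezMl ck; split=> //.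
by case: H => -[X [Y ->]]; [left|right]; exists X, Y; rewrite ?eval_form_scale ?eval_fricke_scale.
Qed.

Lemma genus_values_unscale k Q nu :
  genus_values D N (scale k Q) nu -> exists nu', genus_values D N Q nu'.
Proof.
move=> /(genus_valuesP _ _ _ pN)[cop H].
case: H => -[X [Y E]]; move: cop; rewrite E ?eval_form_scale ?eval_fricke_scale coprimezMl => /andP[_ cop].
  by exists (eval_form N Q X Y); apply/(genus_valuesP _ _ _ pN); split=> //; left; exists X, Y.
by exists (eval_fricke N Q X Y); apply/(genus_valuesP _ _ _ pN); split=> //; right; exists X, Y.
Qed.

Lemma square_modM m k r : square_mod m r -> square_mod (m * k ^+ 2) r.
Proof.
case=> x /eqP; rewrite eqz_mod_dvd => H; exists (x * k); apply/eqP; rewrite eqz_mod_dvd.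
by rewrite exprMn -mulrBl dvdz_mulr.
Qed.

(** The values of Q o g^T are among those of Q; conversely the adjugate shows
    that det(g)^2 nu is a value of Q o g^T for each value nu of Q, so that the
    two sets of values prime to D are empty together. *)
Lemma genus_char_act m g Q : square_mod m (4 * N%:Z) -> admissible N D m Q ->
  gdet N g != 0 -> coprimez (gdet N g) D -> genus_char D N (act N g Q) = genus_char D N Q.
Proof.
move=> sm gQ g0 cg; have gQ' := admissible_act g0 cg gQ.
have sm' := square_modM (gdet N g) sm.
case: (pselect (exists nu, genus_values D N (act N g Q) nu)) => [[nu G]|H].
  by rewrite (genus_char_val sm' gQ' G) (genus_char_val sm gQ (genus_values_act cg G)).
rewrite (genus_char_empty sm' gQ'); last by move=> nu G; apply: H; exists nu.
rewrite (genus_char_empty sm gQ) // => nu G; apply: H; exists (gdet N g ^+ 2 * nu).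
apply: (@genus_values_act (gadj g)); first by rewrite gdet_adj.
rewrite act_adjK; apply: genus_values_scale => //.
by rewrite expr2 coprimezMl cg.
Qed.

Lemma genus_char_scale m p Q : square_mod m (4 * N%:Z) -> admissible N D m Q ->
  prime p -> ~~ (p%:Z %| D)%Z ->
  genus_char D N (scale p%:Z Q) = kronecker D p%:Z * genus_char D N Q.
Proof.
move=> sm gQ pp pD; have cp : coprimez p%:Z D.
  by rewrite coprimezE /= prime_coprime // -[(p %| _)%N]/(p%:Z %| D)%Z.
have p0 := prime_gt0 pp; have p0' : 0 < p%:Z by [].
have gQ' := admissible_scale p0' cp gQ; have sm' := square_modM p%:Z sm.
case: (pselect (exists nu, genus_values D N Q nu)) => [[nu G]|H].
  rewrite (genus_char_val sm' gQ' (genus_values_scale cp G)) (genus_char_val sm gQ G).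
  have [pd dQ _] := gQ.
  have := genus_values_gt0 pN D1 pd G; case: nu G => // n _ n0.
  by rewrite -PoszM !kronecker_jacobi ?jacobiMr ?muln_gt0 ?p0.
rewrite (genus_char_empty sm gQ); last by move=> nu G; apply: H; exists nu.
rewrite mulr0 (genus_char_empty sm' gQ') // => nu G; apply: H.
exact: genus_values_unscale G.
Qed.

(** The fourth power of a Bezout combination of a, b, c lies in the ideal
    generated by their squares, and it is prime to D. *)
Lemma dvd_of_dvd_sqr_mul e a b c : (D %| a ^+ 2 * e)%Z -> (D %| b ^+ 2 * e)%Z ->
  (D %| c ^+ 2 * e)%Z -> gcdz (gcdz (gcdz a b) c) D = 1 -> (D %| e)%Z.
Proof.
move=> Da Db Dc G1; set G := gcdz (gcdz a b) c in G1.
have [u [v Euv]] := Bezoutz a b; have [u' [v' Euv']] := Bezoutz (gcdz a b) c.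
have EG : G = (u' * u) * a + (u' * v) * b + v' * c by rewrite /G -Euv' -Euv; ring.
have cop : coprimez D (G ^+ 4) by rewrite coprimez_sym coprimezXl //; apply/eqP.
rewrite -(Gauss_dvdzr _ cop) EG.
set A := u' * u; set B := u' * v; set C := v'.
have -> : (A * a + B * b + C * c) ^+ 4 * e =
   (a ^+ 2 * e) * (A ^+ 2 * ((A * a) ^+ 2 + 4 * (A * a) * (B * b + C * c) + 6 * (B * b + C * c) ^+ 2))
   + (b ^+ 2 * e) * (B ^+ 2 * ((B * b) ^+ 2 + 4 * (B * b) * (C * c) + 3 * (C * c) ^+ 2
       + 4 * (A * a) * (B * b) + 12 * (A * a) * (C * c)))
   + (c ^+ 2 * e) * (C ^+ 2 * ((C * c) ^+ 2 + 4 * (C * c) * (B * b) + 3 * (B * b) ^+ 2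
       + 4 * (A * a) * (C * c) + 12 * (A * a) * (B * b))) by ring.
by rewrite !rpredD // dvdz_mulr.
Qed.

(** If g fixes Q, then (y, t - x, -z) is proportional to (a, b, c), and with T
    = x + t and M = -disc Q one gets a^2 (4 - T^2) = M y^2. Either y = 0 and g
    is I or -I, or e = 4 - T^2 is 3 or 4 and M, hence D, divides a^2 e, b^2 e
    and c^2 e. *)
Lemma stabilizer_trivial m g Q : admissible N D m Q -> gdet N g = 1 -> act N g Q = Q ->
  g = gscalar 1 \/ g = gscalar (-1).
Proof.
case: g => [[[x y] z] t] [pd dQ cQ] /= dg.
have a0 := posdef_a pd; have d0 := disc_lt0 pd.
move/form_coprimeP: cQ => cQ.
case: Q => [[a b] c] in pd dQ cQ a0 d0 *.
rewrite /coefa /coefb /coefc /disc /= in dQ cQ a0 d0 * => -[Ea Eb Ec].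
have N0 : N%:Z != 0 by have := prime_gt0 pN; clear; lia.
(* Q o g^T = Q is linear in g once one factor is moved to the other side *)
have E1 : b * y = a * (t - x).
  apply: (@mulfI _ 1) => //.
  have : 2 * (a * x ^+ 2 + b * x * y + N%:Z * c * y ^+ 2) * t
       - (2 * N%:Z * a * x * z + b * (x * t + N%:Z * y * z) + 2 * N%:Z * c * y * t) * y
       = (2 * a * x + b * y) * (x * t - N%:Z * y * z) by ring.
  by rewrite Ea Eb dg; clear; lia.
have E2 : c * y = - (a * z).
  apply: (mulfI N0).
  have : (2 * N%:Z * a * x * z + b * (x * t + N%:Z * y * z) + 2 * N%:Z * c * y * t) * x
       - 2 * (a * x ^+ 2 + b * x * y + N%:Z * c * y ^+ 2) * N%:Z * z
       = (b * x + 2 * N%:Z * c * y) * (x * t - N%:Z * y * z) by ring.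
  by rewrite Ea Eb dg; clear; lia.
have an0 : a != 0 by rewrite gt_eqF.
have E3 : b * z = c * (x - t).
  apply: (mulfI an0).
  transitivity (b * (a * z)); first by ring.
  transitivity (- c * (a * (t - x))); last by ring.
  by rewrite -E1 -[a * z]opprK -E2; ring.
set T := x + t; pose M := 4 * N%:Z * a * c - b ^+ 2.
have M0 : 0 < M by rewrite /M -oppr_lt0 opprB.
(* 4 - T^2 is - (t - x)^2 - 4 N y z by the determinant *)
have ET : a ^+ 2 * (4 - T ^+ 2) = M * y ^+ 2.
  have -> : a ^+ 2 * (4 - T ^+ 2) =
    - ((a * (t - x)) ^+ 2 + 4 * N%:Z * a * (a * z) * y)
    + 4 * a ^+ 2 * (1 - (x * t - N%:Z * y * z)) by rewrite /T; ring.
  by rewrite dg subrr mulr0 addr0 -E1 -[a * z]opprK -E2 /M; ring.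
have [y0|y0] := eqVneq y 0.
  have tx : t = x.
    by apply/eqP; rewrite -subr_eq0; move/esym/eqP: E1; rewrite y0 mulr0 mulf_eq0 (negbTE an0).
  have z0 : z = 0.
    by apply/eqP; move/esym/eqP: E2; rewrite y0 mulr0 oppr_eq0 mulf_eq0 (negbTE an0).
  have : x ^+ 2 == 1 by apply/eqP; rewrite -dg tx y0; ring.
  by rewrite sqrf_eq1 tx y0 z0 => /orP[]/eqP->; [left|right].
exfalso.
have a2 : 0 < a ^+ 2 by rewrite exprn_gt0.
have y2 : 0 < y ^+ 2 by rewrite lt_def sqr_ge0 expf_neq0.
have e0 : 0 < 4 - T ^+ 2 by rewrite -(pmulr_rgt0 _ a2) ET mulr_gt0.
have : 4 - T ^+ 2 = 3 \/ 4 - T ^+ 2 = 4.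
  have : T = 0 \/ T = 1 \/ T = -1 by clear -e0; nia.
  by case=> [->|[->|->]]; [right|left|left].
move: e0 ET; set e := 4 - T ^+ 2 => e0 ET He.
apply: (fundamental_ndvd_3_4 D1 fD He).
have DM k : (D %| M * k)%Z.
  rewrite dvdz_mulr // (_ : M = D * (- m)) ?dvdz_mulr // /M mulrN -dQ; ring.
apply: (@dvd_of_dvd_sqr_mul e a b c) => //; first by rewrite ET.
  rewrite (_ : b ^+ 2 * e = M * (t - x) ^+ 2) //.
  apply: (@mulfI _ (a ^+ 2)); first by rewrite gt_eqF.
  transitivity (b ^+ 2 * (a ^+ 2 * e)); first by ring.
  rewrite ET; transitivity (M * (a * (t - x)) ^+ 2); last by ring.
  by rewrite -E1; ring.
rewrite (_ : c ^+ 2 * e = M * z ^+ 2) //.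
apply: (@mulfI _ (a ^+ 2)); first by rewrite gt_eqF.
transitivity (c ^+ 2 * (a ^+ 2 * e)); first by ring.
rewrite ET; transitivity (M * (- (a * z)) ^+ 2); last by ring.
by rewrite -E2; ring.
Qed.
End Chi.

(** * Orbits and stabilizers *)

Lemma mx2_eq (R : Type) (A B : 'M[R]_2) :
  A 0 0 = B 0 0 -> A 0 1 = B 0 1 -> A 1 0 = B 1 0 -> A 1 1 = B 1 1 -> A = B.
Proof.
move=> h00 h01 h10 h11; apply/matrixP => i j.
have E (k : 'I_2) : k = 0 \/ k = 1.
  by case: k => [[|[|//]] Hk]; [left|right]; apply: val_inj.
by case: (E i) => ->; case: (E j) => ->.
Qed.

Lemma mx2_inj (R : Type) (x y z t x' y' z' t' : R) :
  mx2 x y z t = mx2 x' y' z' t' -> [/\ x = x', y = y', z = z' & t = t'].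
Proof.
move=> E; split.
- by have := congr1 (fun A : 'M[R]_2 => A 0 0) E; rewrite !mxE.
- by have := congr1 (fun A : 'M[R]_2 => A 0 1) E; rewrite !mxE.
- by have := congr1 (fun A : 'M[R]_2 => A 1 0) E; rewrite !mxE.
- by have := congr1 (fun A : 'M[R]_2 => A 1 1) E; rewrite !mxE.
Qed.

Lemma mx2_eta (R : Type) (A : 'M[R]_2) : A = mx2 (A 0 0) (A 0 1) (A 1 0) (A 1 1).
Proof. by apply: mx2_eq; rewrite mxE. Qed.

Lemma mul_mx2 (R : nzRingType) (x y z t x' y' z' t' : R) :
  mx2 x y z t *m mx2 x' y' z' t' =
  mx2 (x * x' + y * z') (x * y' + y * t') (z * x' + t * z') (z * y' + t * t').
Proof. by apply: mx2_eq; rewrite !mxE !big_ord_recl big_ord0 addr0 !mxE. Qed.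

Lemma det_mx2 (R : comNzRingType) (x y z t : R) : \det (mx2 x y z t) = x * t - y * z.
Proof.
rewrite (expand_det_row _ 0) !big_ord_recl big_ord0 addr0 /cofactor !det_mx11 !mxE /=.
by rewrite expr0 expr1 mul1r mulN1r mulrN.
Qed.

Definition gmx (N : nat) (g : level_mat) : 'M[int]_2 :=
  let: (x, y, z, t) := g in mx2 x y (N%:Z * z) t.

Lemma det_gmx N g : \det (gmx N g) = gdet N g.
Proof. by case: g => [[[x y] z] t] /=; rewrite det_mx2; ring. Qed.

Lemma Gamma0P N A : Gamma0 N A <-> exists2 g, gdet N g = 1 & A = gmx N g.
Proof.
split=> [[dA /dvdzP[z Ez]]|[g dg ->]].
  have EA : A = gmx N (A 0 0, A 0 1, z, A 1 1) by rewrite /gmx [LHS]mx2_eta Ez mulrC.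
  by exists (A 0 0, A 0 1, z, A 1 1); rewrite // -det_gmx -EA.
split; first by rewrite det_gmx.
by case: g {dg} => [[[x y] z] t]; rewrite /= mxE /= dvdz_mulr.
Qed.

Lemma lambda_inj N : (0 < N)%N -> injective (lambda N).
Proof.
move=> N0 [[a b] c] [[a' b'] c']; rewrite /lambda => H; have [] := mx2_inj H.
rewrite /coefa /coefb /coefc /= => Eb Ea Ec _.
have N0r : N%:R != 0 :> rat by rewrite pnatr_eq0 -lt0n.
have N2r : 2 * N%:R != 0 :> rat by rewrite mulf_neq0.
move/oppr_inj: Ea => /(divIf N0r)/intr_inj->; move: Eb => /(divIf N2r)/intr_inj->.
by move/intr_inj: Ec => ->.
Qed.

Lemma conj_lambda N g Q : (0 < N)%N -> gdet N g = 1 ->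
  conj_mx (gmx N g) (lambda N Q) = lambda N (act N g Q).
Proof.
move=> N0 dg; have N0r : N%:R != 0 :> rat by rewrite pnatr_eq0 -lt0n.
rewrite /conj_mx; set G := map_mx _ _.
have GU : G \in unitmx.
  by rewrite unitmxE det_map_mx det_gmx dg unitr1.
rewrite -[RHS](mulmxK GU); congr (_ *m _).
have dgr : (gdet N g)%:~R = 1 :> rat by rewrite dg.
move: dg dgr; rewrite /G {G GU}; case: g => [[[x y] z] t] /= dg dgr.
have -> : map_mx (fun z0 : int => z0%:~R : rat) (mx2 x y (N%:Z * z) t)
  = mx2 x%:~R y%:~R (N%:R * z%:~R) t%:~R.
  by apply: mx2_eq; rewrite !mxE //= intrM.
case: Q => [[a b] c]; rewrite /lambda !mul_mx2 /coefa /coefb /coefc /=.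
have E1 : x%:~R * t%:~R - N%:R * y%:~R * z%:~R = 1 :> rat.
  by rewrite -[RHS]dgr rmorphB /= !intrM.
have E (k : rat) : k = k * (x%:~R * t%:~R - N%:R * y%:~R * z%:~R) by rewrite E1 mulr1.
congr mx2; rewrite [LHS]E; field; exact: N0r.
Qed.

Lemma orbit_ofP N Q Q' : (0 < N)%N ->
  orbit_of N Q Q' <-> exists2 g, gdet N g = 1 & Q' = act N g Q.
Proof.
move=> N0; split=> [[A /Gamma0P[g dg ->]]|[g dg ->]].
  by rewrite conj_lambda // => /(lambda_inj N0) ->; exists g.
exists (gmx N g); first by apply/Gamma0P; exists g.
by rewrite conj_lambda.
Qed.

Lemma orbit_of_refl N Q : (0 < N)%N -> orbit_of N Q Q.
Proof. by move=> N0; apply/orbit_ofP => //; exists (gscalar 1); rewrite ?act1 //= mulr0 subr0. Qed.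

Lemma orbit_of_sym N Q Q' : (0 < N)%N -> orbit_of N Q Q' -> orbit_of N Q' Q.
Proof.
move=> N0 /(orbit_ofP _ _ N0)[g dg ->]; apply/(orbit_ofP _ _ N0).
by exists (gadj g); rewrite ?gdet_adj // act_adjK dg scale1.
Qed.

Lemma orbit_of_trans N Q Q' Q'' : (0 < N)%N -> orbit_of N Q Q' -> orbit_of N Q' Q'' -> orbit_of N Q Q''.
Proof.
move=> N0 /(orbit_ofP _ _ N0)[g dg ->] /(orbit_ofP _ _ N0)[h dh ->]; apply/(orbit_ofP _ _ N0).
by exists (gmul N h g); rewrite ?gdet_mul ?dg ?dh // act_mul.
Qed.

Lemma orbit_of_eq N Q Q' : (0 < N)%N -> orbit_of N Q Q' -> orbit_of N Q = orbit_of N Q'.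
Proof.
move=> N0 QQ'; apply/seteqP; split=> R.
  by apply: orbit_of_trans => //; apply: orbit_of_sym.
exact: orbit_of_trans.
Qed.

(** By stabilizer_trivial; as a set of cosets it has one element, which gives
    the class the weight one. *)
Lemma stabilizer_admissible N D m Q : prime N -> 1 < D -> fundamental_discriminant D ->
  admissible N D m Q -> stabilizer N Q = [set [set 1%:M; - 1%:M]]%classic.
Proof.
move=> pN D1 fD gQ; have N0 := prime_gt0 pN.
have E1 : gmx N (gscalar 1) = 1%:M by apply: mx2_eq; rewrite !mxE ?mulr0.
have EN1 : gmx N (gscalar (-1)) = - 1%:M by apply: mx2_eq; rewrite !mxE ?mulr0 ?oppr0.
apply/seteqP; split=> C /=.
  case=> -[A /Gamma0P[g dg EA] <-] /(_ A (or_introl erefl)).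
  rewrite EA conj_lambda // => /(lambda_inj N0) /(stabilizer_trivial pN D1 fD gQ dg).
  case=> ->; rewrite ?E1 ?EN1 // opprK; apply/seteqP; split=> x /=; tauto.
move=> ->; split; first by exists 1%:M => //; apply/Gamma0P; exists (gscalar 1) => //=; rewrite mulr0 subr0.
move=> A /= [->|->].
  by rewrite -E1 conj_lambda ?act1 //= mulr0 subr0.
rewrite -EN1 conj_lambda //; first by rewrite act_gscalar sqrrN expr1n scale1.
by rewrite /=; ring.
Qed.

Lemma gdet1 N : gdet N (gscalar 1) = 1.
Proof. by rewrite /= mulr0 subr0 mulr1. Qed.

(** * Finiteness of the set of classes *)

(** Take the smallest first coefficient in the class, and then translate the
    middle coefficient into the interval [-a, a]; the exchange of the
    variables shows that the last coefficient is not smaller. *)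
Lemma sl2_reduction F : posdef 1 F -> exists2 h, gdet 1 h = 1 &
  let R := act 1 h F in `|coefb R| <= coefa R /\ coefa R <= coefc R.
Proof.
move=> pd.
pose P (n : nat) := `[< exists2 h, gdet 1 h = 1 & coefa (act 1 h F) = n%:Z >].
have pdh h : gdet 1 h = 1 -> posdef 1 (act 1 h F) by move=> dh; apply: posdef_act; rewrite // dh.
have exP : exists n, P n.
  exists `|coefa F|%N; apply/asboolP; exists (gscalar 1); rewrite ?gdet1 // act1.
  by rewrite gez0_abs // ltW // (posdef_a pd).
case: (ex_minnP exP) => n /asboolP[h dh En] minn.
have a0 := posdef_a (pdh h dh).
set R := act 1 h F in En a0.
(* the multiple of 2 a that brings b into [-a, a) *)
pose z := - ((coefb R + coefa R) %/ (2 * coefa R))%Z.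
have dT : gdet 1 (1, 0, z, 1) = 1 by rewrite /=; ring.
pose g := gmul 1 (1, 0, z, 1) h; have dg : gdet 1 g = 1 by rewrite gdet_mul dT dh.
exists g => //; rewrite /= {1 2 3 4}/g act_mul -/R.
have Ea : coefa (act 1 (1, 0, z, 1) R) = coefa R.
  by case: (R) => [[a b] c]; rewrite /coefa /=; ring.
have Eb : coefb (act 1 (1, 0, z, 1) R) = coefb R + 2 * coefa R * z.
  by case: (R) => [[a b] c]; rewrite /coefa /coefb /=; ring.
split.
  rewrite Ea Eb /z; move: a0; move: (coefa R) (coefb R) => a b a0.
  have := divz_eq (b + a) (2 * a); have := @modz_ge0 (b + a) (2 * a).
  have := @ltz_pmod (b + a) (2 * a); move: (_ %/ _)%Z (_ %% _)%Z => q r.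
  by rewrite mulrN mulrC; move: (q * (2 * a)) => X; lia.
rewrite Ea En.
have dS : gdet 1 (gmul 1 (0, 1, -1, 0) g) = 1 by rewrite gdet_mul dg /=; ring.
have a1 := posdef_a (pdh _ dS).
have Ec : coefa (act 1 (gmul 1 (0, 1, -1, 0) g) F) = coefc (act 1 (1, 0, z, 1) R).
  rewrite act_mul /g act_mul -/R; case: (act 1 (1, 0, z, 1) R) => [[a b] c].
  by rewrite /coefa /coefc /=; ring.
have : P (absz (coefc (act 1 ((1, 0, z, 1) : level_mat) R))).
  by apply/asboolP; exists (gmul 1 (0, 1, -1, 0) g); rewrite // Ec gez0_abs // -Ec ltW.
move/minn; rewrite Ec in a1; clear -a1; lia.
Qed.

Lemma reduced_bound (a b c M : int) : 0 < a -> `|b| <= a -> a <= c ->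
  M = 4 * a * c - b ^+ 2 -> [/\ a <= M, `|b| <= M & c <= M].
Proof.
move=> a0 ba ac EM.
have b2 : b ^+ 2 <= a * c.
  by rewrite -(real_normK (num_real b)) expr2; apply: ler_pM => //; apply: le_trans ba ac.
have c0 : 0 < c by apply: lt_le_trans ac.
have : c <= M by rewrite EM; nia.
by move=> cM; split=> //; [apply: le_trans cM | apply: le_trans ba (le_trans ac cM)].
Qed.

(** A form is a reduced form transformed by a matrix h of SL2(Z); if two forms
    share the reduced form, and the matrices agree modulo N, the quotient of
    the matrices is congruent to I modulo N, so it lies in Gamma0(N). Hence
    the classes are indexed by a finite set of reduced forms and residues. *)
Lemma finite_orbits N M : (0 < N)%N -> finite_set (orbits N M).
Proof.
move=> N0; pose m := `|M|%N.
(* coefficients of a reduced form, the middle one shifted by m to be a natural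
   number, and the entries of the matrix modulo N *)
pose K : finType := ('I_m.+1 * 'I_(m + m).+1 * 'I_m.+1 * ('I_N * 'I_N * 'I_N * 'I_N))%type.
pose rel (k : K) (Q : form) := let: (kA, kB, kC, (kx, ky, kz, kt)) := k in
  exists h : level_mat, [/\ gdet 1 h = 1,
    ((coefa Q, coefb Q, N%:Z * coefc Q) : form) =
      act 1 h ((kA : nat)%:Z, (kB : nat)%:Z - m%:Z, (kC : nat)%:Z)
   & let: (x, y, z, t) := h in [/\ (x %% N)%Z = kx, (y %% N)%Z = ky, (z %% N)%Z = kz & (t %% N)%Z = kt]].
pose cls (k : K) : set form := (fun Q : form => forms N M Q /\ rel k Q).
pose f (k : K) := orbit_of N (xget (0, 0, 0) (cls k)).
apply: (@sub_finite_set _ _ (range f)); last by apply: finite_image; exact: finite_finset.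
move=> O [Q [pd dQ] <-].
have same k Q1 Q2 : rel k Q1 -> rel k Q2 -> orbit_of N Q1 Q2.
  case: k => [[[kA kB] kC] [[[kx ky] kz] kt]] [h1 [d1 E1 c1]] [h2 [d2 E2 c2]].
  pose k := gmul 1 h2 (gadj h1).
  have E12 : act 1 k (coefa Q1, coefb Q1, N%:Z * coefc Q1) = (coefa Q2, coefb Q2, N%:Z * coefc Q2).
    by rewrite E1 E2 /k act_mul act_adjK d1 expr1n scale1.
  have dk : gdet 1 k = 1 by rewrite gdet_mul gdet_adj d1 d2.
  have [x [y [z [t Ek]]]] : exists x y z t, k = (x, y, N%:Z * z, t).
    rewrite /k; move: c1 c2; case: (h1) => [[[x1 y1] z1] t1]; case: (h2) => [[[x2 y2] z2] t2] /=.
    case=> _ _ z1k t1k [_ _ z2k t2k].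
    have : (N%:Z %| z2 * t1 - t2 * z1)%Z.
      by rewrite -eqz_mod_dvd -modzMm z2k t1k -[(t2 * z1 %% _)%Z]modzMm z1k t2k mulrC.
    by case/dvdzP=> z Ez; exists (x2 * t1 + 1 * y2 * - z1), (x2 * - y1 + y2 * x1), z,
      (1 * z2 * - y1 + t2 * x1); congr (_, _, _, _); rewrite [RHS]mulrC -Ez; ring.
  apply/orbit_ofP => //; exists (x, y, z, t); first by rewrite -dk Ek /=; ring.
  move: E12; rewrite Ek; case: (Q1) => [[a b] c]; case: (Q2) => [[a' b'] c'].
  rewrite /coefa /coefb /coefc /= => -[<- <- Ec]; congr (_, _, _); try ring.
  have N0z : N%:Z != 0 by clear -N0; lia.
  by apply: (mulfI N0z); rewrite -Ec; ring.
have [k Qk] : exists k : K, rel k Q.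
  have pd1 : posdef 1 (coefa Q, coefb Q, N%:Z * coefc Q).
    by move=> X Y XY; have := pd X Y XY; rewrite /coefa /coefb /coefc /= mul1r.
  have [h dh] := sl2_reduction pd1.
  have pdR : posdef 1 (act 1 h (coefa Q, coefb Q, N%:Z * coefc Q)) by apply: posdef_act; rewrite ?dh.
  have dR : disc 1 (act 1 h (coefa Q, coefb Q, N%:Z * coefc Q)) = - M.
    by rewrite disc_act dh -dQ /disc /coefa /coefb /coefc /=; ring.
  set R := act 1 h _ in pdR dR *; move=> /= [ba ac].
  have a0 := posdef_a pdR.
  have [] := @reduced_bound (coefa R) (coefb R) (coefc R) M a0 ba ac.
    by rewrite -[M]opprK -dR /disc; ring.
  have M0 : 0 < M by rewrite -oppr_lt0 -dR; apply: disc_lt0.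
  move=> aM bM cM.
  have ER : act 1 (gadj h) R = (coefa Q, coefb Q, N%:Z * coefc Q).
    by rewrite /R act_adjK dh expr1n scale1.
  have dh' : gdet 1 (gadj h) = 1 by rewrite gdet_adj.
  case: (gadj h) dh' ER => [[[x y] z] t] dh' ER.
  have Hr (u : int) : exists i : 'I_N, (u %% N)%Z = (i : nat).
    have NZ : 0 < N%:Z by clear -N0; lia.
    have u0 : 0 <= (u %% N)%Z by apply: modz_ge0; rewrite gt_eqF.
    have uN := ltz_pmod u NZ.
    have lt : (`|(u %% N)%Z| < N)%N by clear -u0 uN; lia.
    by exists (Ordinal lt) => /=; rewrite gez0_abs.
  have [kx Ex] := Hr x; have [ky Ey] := Hr y; have [kz Ez] := Hr z; have [kt Et] := Hr t.
  have lA : (`|coefa R| < m.+1)%N by rewrite /m; clear -aM a0; lia.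
  have lC : (`|coefc R| < m.+1)%N by rewrite /m; clear -cM ac a0; lia.
  have lB : (absz (coefb R + m%:Z)%R < (m + m).+1)%N by rewrite /m; clear -bM M0; lia.
  have ER' : R = ((absz (coefa R))%:Z, (absz (coefb R + m%:Z)%R)%:Z - m%:Z, (absz (coefc R))%:Z).
    rewrite [LHS]surjective_pairing [X in (X, _)]surjective_pairing; congr (_, _, _).
    - by rewrite -[LHS]/(coefa R); clear -a0; lia.
    - by rewrite -[LHS]/(coefb R) /m; clear -bM M0; lia.
    - by rewrite -[LHS]/(coefc R); clear -a0 ac; lia.
  exists (Ordinal lA, Ordinal lB, Ordinal lC, (kx, ky, kz, kt)), (x, y, z, t).
  by split=> //; rewrite -ER {1}ER'.
exists k => //; rewrite /f.
have [_ rk] : cls k (xget (0, 0, 0) (cls k)) by apply: xgetPex; exists Q.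
by apply/esym/orbit_of_eq => //; apply: same Qk rk.
Qed.

(** * Representatives of the classes *)

Definition equivf (N : nat) (Q Q' : form) : bool := `[< exists2 g, gdet N g = 1 & Q' = act N g Q >].

Lemma equivfP N Q Q' : (0 < N)%N -> equivf N Q Q' <-> orbit_of N Q Q'.
Proof.
move=> N0; split=> [/asboolP H|/(orbit_ofP _ _ N0) H]; first exact/orbit_ofP.
exact/asboolP.
Qed.

Lemma admissible_orbit N D m Q Q' : (0 < N)%N -> admissible N D m Q -> orbit_of N Q Q' -> admissible N D m Q'.
Proof.
move=> N0 gQ /(orbit_ofP _ _ N0)[g dg ->].
have -> : m = m * gdet N g ^+ 2 by rewrite dg expr1n mulr1.
by apply: admissible_act => //; rewrite dg // coprimezE /= coprime1n.
Qed.

Lemma form_coprime_orbit N D Q Q' : (0 < N)%N -> form_coprime D Q -> orbit_of N Q Q' -> form_coprime D Q'.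
Proof.
move=> N0 gQ /(orbit_ofP _ _ N0)[g dg ->].
by apply: form_coprime_act => //; rewrite dg // coprimezE /= coprime1n.
Qed.

Lemma card_pm_identity : #|` fset_set [set [set 1%:M; - 1%:M : 'M[int]_2]]%classic| = 1%N.
Proof. by rewrite fset_set1 cardfs1. Qed.

(** Replaces the sum over all orbits by one over a sequence that meets each
    class of admissible forms once: the other classes contribute nothing,
    since chi vanishes on them, and the weights are one. *)
Lemma class_representatives N D d : prime N -> 1 < D -> fundamental_discriminant D ->
  exists s : seq form, [/\ forall Q, Q \in s -> admissible N D (- d) Q,
    forall Q, admissible N D (- d) Q -> count (equivf N Q) s = 1%N
    & twisted_class_number N D d = (\sum_(Q <- s) genus_char D N Q)%:~R].
Proof.
move=> pN D1 fD; have N0 := prime_gt0 pN.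
have finO := @finite_orbits N (d * D) N0.
pose cop (U : set form) := `[< form_coprime D (xget (0, 0, 0) U) >].
pose r (U : set form) : form := xget (0, 0, 0) U.
pose s := [seq r U | U <- fset_set (orbits N (d * D)) & cop U].
have memO U : U \in fset_set (orbits N (d * D)) -> exists2 Q, forms N (d * D) Q & U = orbit_of N Q.
  by rewrite in_fset_set // inE => -[Q fQ <-]; exists Q.
have rO Q : orbit_of N Q (r (orbit_of N Q)).
  by apply: xgetPex; exists Q; apply: orbit_of_refl.
have goodr U : U \in fset_set (orbits N (d * D)) -> cop U -> admissible N D (- d) (r U).
  case/memO => Q [pd dQ] -> /asboolP cQ.
  have QO := rO Q; have cQ' := form_coprime_orbit N0 cQ (orbit_of_sym N0 QO).
  by apply: (admissible_orbit N0 _ QO); split=> //; rewrite dQ; ring.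
exists s; split.
- by move=> Q /mapP[U]; rewrite mem_filter => /andP[cO UU] ->; apply: goodr.
- move=> Q gQ; rewrite /s count_map count_filter.
  have fQ : forms N (d * D) Q by case: gQ => pd dQ _; split=> //; rewrite dQ; ring.
  have UU : orbit_of N Q \in fset_set (orbits N (d * D)).
    by rewrite in_fset_set // inE; exists Q.
  rewrite -(@eq_in_count _ (pred1 (orbit_of N Q))).
    by rewrite count_uniq_mem ?UU // fset_uniq.
  move=> U /memO[R fR ->] /=; apply/idP/andP => [/eqP ->|[/(equivfP _ _ N0) QR _]].
    split; first exact/equivfP.
    by apply/asboolP; apply: (form_coprime_orbit N0 _ (rO Q)); case: gQ.
  by apply/eqP; rewrite (orbit_of_eq N0 QR); apply: orbit_of_eq N0 (rO R).
rewrite /twisted_class_number fsbig_finite //= /s big_map big_filter rmorph_sum /= [RHS]big_mkcond /=.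
rewrite big_seq [RHS]big_seq; apply: eq_bigr => U UU.
case: ifP => [cU|/asboolP nU]; last by rewrite genus_char_bad // mul0r.
have gO := goodr U UU cU.
by rewrite (stabilizer_admissible pN D1 fD gO) card_pm_identity divr1.
Qed.

(** * Zeros of binary quadratic forms modulo p *)

Lemma card_sqrt (F : finFieldType) (e : F) : (2 : F) != 0 ->
  (\sum_(y : F) (y ^+ 2 == e)%:R : int) = 1 + legendre e.
Proof.
move=> two0; rewrite /legendre; case: eqP => [->|/eqP e0].
  rewrite (bigD1 0) //= expr0n eqxx big1 // => y /negbTE y0.
  by rewrite expf_eq0 /= y0.
case: ifP => [/existsP[y /eqP Ey]|/negbT].
  have y0 : y != 0 by apply: contraNneq e0 => y0; rewrite -Ey y0 expr0n.
  have yN : - y != y.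
    rewrite -subr_eq0 -opprD oppr_eq0 -mulr2n -mulr_natl mulf_neq0 //.
  rewrite (bigD1 y) //= Ey eqxx (bigD1 (- y)) //= sqrrN Ey eqxx big1 // => z /andP[zy zNy].
  by rewrite -Ey eqf_sqr (negbTE zy) (negbTE zNy).
rewrite negb_exists => /forallP H; rewrite big1 // => y _.
by rewrite (negbTE (H y)).
Qed.

Lemma sum_Fp (p : nat) (G : nat -> int) : prime p ->
  \sum_(j < p) G j = \sum_(x : 'F_p) G (x : nat).
Proof. by move=> pp; rewrite -(big_mkord xpredT G) -[in LHS](Fp_cast pp) big_mkord. Qed.

(** If c is a unit modulo p, completing the square identifies the zeros with
    the square roots of the discriminant; if p divides c, the point at
    infinity is a zero and the remaining equation is linear. Only the zero
    form has p + 1 zeros, which is 1 modulo p as well. *)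
Lemma root_count_odd (p : nat) (a b c : int) : prime p -> odd p ->
  (p%:Z %| \sum_(j < p) ((p%:Z %| (a + b * j%:Z + c * j%:Z ^+ 2))%Z)%:R
     + ((p%:Z %| c)%Z)%:R - (1 + kronecker_prime (b ^+ 2 - 4 * a * c) p))%Z.
Proof.
move=> pp op; have two0 := Fp2_neq0 pp op.
have cF := card_Fp pp.
rewrite (sum_Fp (fun j => ((p%:Z %| (a + b * j%:Z + c * j%:Z ^+ 2))%Z)%:R)) //.
rewrite -(intr_eq0_Fp c pp) kronecker_primeE // intrB rmorphXn !intrM /=.
under eq_bigr => x _ do rewrite -(intr_eq0_Fp _ pp) expr2 !intrD !intrM -!pmulrn !natr_Zp -expr2.
move: (a%:~R) (b%:~R) (c%:~R) => {}a {}b {}c.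
have [c0|c0] := eqVneq c 0.
  rewrite c0 !mulr0 subr0.
  under eq_bigr => x _ do rewrite mul0r addr0.
  have [b0|b0] := eqVneq b 0.
    rewrite b0 expr0n /=; under eq_bigr => x _ do rewrite mul0r addr0.
    rewrite sumr_const cF /legendre eqxx addr0 addrK.
    by case: (a == 0) => /=; [rewrite mulr1n natz dvdzz | rewrite mulr0n mul0rn dvdz0].
  rewrite (bigD1 (- a / b)) //= mulrC divfK // addrN eqxx big1 ?addr0; last first.
    move=> x xab; rewrite addrC addr_eq0.
    by have -> : (b * x == - a) = false; last by []; apply: contraNF xab => /eqP <-; rewrite mulrC mulKf.
  rewrite expr2 legendreM ?cF // legendre_mulxx // subrr; exact: dvdz0.
have fc0 : 2 * c != 0 by rewrite mulf_neq0.
have -> : \sum_(x : 'F_p) (a + b * x + c * x ^+ 2 == 0)%:R = 1 + legendre (b ^+ 2 - 4%:~R * a * c) :> int.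
  rewrite -card_sqrt // [RHS](reindex_inj (addIr b)) (reindex_inj (mulfI fc0)) /=.
  apply: eq_bigr => x _; congr (_ %:R); congr (nat_of_bool _).
  rewrite -[in RHS]subr_eq0.
  have -> : (2 * c * x + b) ^+ 2 - (b ^+ 2 - 4%:~R * a * c) = 2 * (2 * c) * (a + b * x + c * x ^+ 2) by ring.
  by rewrite mulf_eq0 (mulf_eq0 2) (negbTE two0) (negbTE fc0).
by rewrite addr0 subrr dvdz0.
Qed.

Lemma root_count_2 (a b c : int) :
  (2%:Z %| \sum_(j < 2) ((2%:Z %| (a + b * j%:Z + c * j%:Z ^+ 2))%Z)%:R
     + ((2%:Z %| c)%Z)%:R - (1 + kronecker_prime (b ^+ 2 - 4 * a * c) 2))%Z.
Proof.
rewrite !big_ord_recl big_ord0 addr0 /= mulr0 addr0 expr0n mulr0 addr0 expr1n !mulr1.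
have Ek : (kronecker_prime (b ^+ 2 - 4 * a * c) 2 == 0) = (2%:Z %| b)%Z.
  by rewrite kronecker_prime_eq0; have := sqr_mod2 b; rewrite -mulrA; lia.
have := kronecker_prime_cases (b ^+ 2 - 4 * a * c) 2; move: Ek; move: (kronecker_prime _ _) => k Ek Hk.
have -> : (2 %| (2%:Z %| a)%Z%:R + (2%:Z %| a + b + c)%Z%:R + (2%:Z %| c)%Z%:R - (1 + k))%Z
  = ((2%:Z %| a)%Z (+) (2%:Z %| a + b + c)%Z (+) (2%:Z %| c)%Z (+) (k != 0)).
  have Ek' : k = 0 \/ k = 1 \/ k = -1 by move: Hk; rewrite !inE => /or3P[]/eqP; tauto.
  by case: (2%:Z %| a)%Z; case: (2%:Z %| a + b + c)%Z; case: (2%:Z %| c)%Z; case: Ek' => [->|[->|->]].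
rewrite Ek; clear.
have -> : (2%:Z %| a + b + c)%Z = (2%:Z %| a)%Z (+) (2%:Z %| b)%Z (+) (2%:Z %| c)%Z by lia.
by case: (2%:Z %| a)%Z; case: (2%:Z %| b)%Z; case: (2%:Z %| c)%Z.
Qed.

(** The term in c is the point at infinity of the projective line. *)
Lemma root_count (p : nat) (a b c : int) : prime p ->
  (p%:Z %| \sum_(j < p) ((p%:Z %| (a + b * j%:Z + c * j%:Z ^+ 2))%Z)%:R
     + ((p%:Z %| c)%Z)%:R - (1 + kronecker_prime (b ^+ 2 - 4 * a * c) p))%Z.
Proof.
move=> pp; case: (even_prime pp) => [E|op]; first by subst p; exact: root_count_2.
exact: root_count_odd.
Qed.

(** The condition that the form becomes divisible by p^2 when it is restricted
    to the sublattice of index p attached to the zero j. *)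
Definition double_root (p : nat) (a b c : int) (j : int) : bool :=
  (p%:Z ^+ 2 %| a + b * j + c * j ^+ 2)%Z && (p%:Z %| b + 2 * c * j)%Z.

Lemma ord_div_ex (p : nat) (u v : int) : prime p -> ~~ (p%:Z %| u)%Z ->
  exists j : 'I_p, (p%:Z %| v + u * j%:Z)%Z.
Proof.
move=> pp pu.
have cop : coprimez u p%:Z.
  by rewrite coprimez_sym coprimezE /= prime_coprime // -[(p %| _)%N]/(p%:Z %| u)%Z.
have [[w k] /= E] := coprimezP _ _ cop.
have p0 : 0 < p%:Z by have := prime_gt0 pp; lia.
have r0 : 0 <= (- v * w %% p%:Z)%Z by apply: modz_ge0; rewrite gt_eqF.
have rp := ltz_pmod (- v * w) p0.
have lt : (absz (- v * w %% p%:Z)%Z < p)%N by lia.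
exists (Ordinal lt) => /=; rewrite gez0_abs //.
have -> : (- v * w %% p%:Z)%Z = - v * w - (- v * w %/ p%:Z)%Z * p%:Z.
  by rewrite {2}(divz_eq (- v * w) p%:Z) addrAC subrr add0r.
apply/dvdzP; exists (v * k - u * (- v * w %/ p%:Z)%Z).
have Ev : v = v * (w * u + k * p%:Z) by rewrite E mulr1.
by rewrite {1}Ev; ring.
Qed.

Lemma ord_div_inj (p : nat) (u v : int) (i j : 'I_p) : prime p -> ~~ (p%:Z %| u)%Z ->
  (p%:Z %| v + u * i%:Z)%Z -> (p%:Z %| v + u * j%:Z)%Z -> i = j.
Proof.
move=> pp pu Hi Hj.
have : (p%:Z %| u * (i%:Z - j%:Z))%Z.
  have -> : u * (i%:Z - j%:Z) = (v + u * i%:Z) - (v + u * j%:Z) by ring.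
  by rewrite rpredB.
rewrite Gauss_dvdzr; last by rewrite coprimezE /= prime_coprime // -[(p %| _)%N]/(p%:Z %| u)%Z.
rewrite -eqz_mod_dvd !modz_nat !modn_small //.
by move=> /eqP [E]; apply: val_inj.
Qed.

(** A form that is not zero modulo p and has discriminant zero modulo p is a
    multiple of the square of a linear form; the hypothesis on p^2 lifts its
    double zero. *)
Lemma double_root_count_odd (p : nat) (a b c M : int) : prime p -> odd p ->
  ~ [/\ (p%:Z %| a)%Z, (p%:Z %| b)%Z & (p%:Z %| c)%Z] -> b ^+ 2 - 4 * a * c = p%:Z ^+ 2 * M ->
  \sum_(j < p) (double_root p a b c j%:Z)%:R + ((p%:Z %| b)%Z && (p%:Z ^+ 2 %| c)%Z)%:R = 1%R :> int.
Proof.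
move=> pp op prim dM.
have cop2 : coprimez (p%:Z ^+ 2) 2 by rewrite coprimezXl // coprimezE /= coprimen2.
have cop4 : coprimez (p%:Z ^+ 2) 4 by rewrite (_ : 4 = 2 * 2) // coprimezMr cop2.
have cop1 (u : int) : ~~ (p%:Z %| u)%Z -> coprimez (p%:Z ^+ 2) u.
  by move=> pu; rewrite coprimezXl // coprimezE /= prime_coprime // -[(p %| _)%N]/(p%:Z %| u)%Z.
have [pc|pc] := boolP (p%:Z %| c)%Z.
  have pb : (p%:Z %| b)%Z.
    have : (p%:Z %| b ^+ 2)%Z.
      have -> : b ^+ 2 = p%:Z * (p%:Z * M) + 4 * a * c by rewrite mulrA -expr2 -dM; ring.
      by apply: rpredD; [apply: dvdz_mulr | apply: dvdz_mull].
    by rewrite !dvdzE abszX /= Euclid_dvdX // => /andP[].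
  have pa : ~~ (p%:Z %| a)%Z by apply/negP => pa; apply: prim.
  have p2c : (p%:Z ^+ 2 %| c)%Z.
    rewrite -(Gauss_dvdzr _ cop4) -(Gauss_dvdzr _ (cop1 _ pa)).
    have -> : a * (4 * c) = b ^+ 2 - p%:Z ^+ 2 * M by rewrite -dM; ring.
    by apply: rpredB; [apply: dvdz_exp2r | apply: dvdz_mulr].
  rewrite pb p2c big1 // => j _; rewrite /double_root.
  have -> // : (p%:Z ^+ 2 %| a + b * j%:Z + c * j%:Z ^+ 2)%Z = false.
  apply: contraNF pa => H; have {}H : (p%:Z %| a + b * j%:Z + c * j%:Z ^+ 2)%Z.
    by apply: dvdz_trans H; rewrite expr2 dvdz_mulr.
  have -> : a = (a + b * j%:Z + c * j%:Z ^+ 2) - (b * j%:Z + c * j%:Z ^+ 2) by ring.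
  by apply: rpredB => //; apply: rpredD; apply: dvdz_mulr.
have p2c : (p%:Z ^+ 2 %| c)%Z = false.
  by apply: contraNF pc; apply: dvdz_trans; rewrite expr2 dvdz_mulr.
have p2cN : ~~ (p%:Z %| 2 * c)%Z.
  rewrite Gauss_dvdzr // coprimezE /= coprimen2 //.
have [j0 Hj0] := ord_div_ex b pp p2cN.
rewrite p2c andbF addr0 (bigD1 j0) //= big1 ?addr0; last first.
  move=> j jj0; rewrite /double_root; case: (boolP (p%:Z %| b + 2 * c * j%:Z)%Z); rewrite ?andbF // => Hj.
  by case/eqP: jj0; apply: ord_div_inj Hj Hj0.
rewrite /double_root Hj0 andbT.
have -> // : (p%:Z ^+ 2 %| a + b * j0%:Z + c * j0%:Z ^+ 2)%Z.
rewrite -(Gauss_dvdzr _ cop4) -(Gauss_dvdzr _ (cop1 _ pc)).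
have -> : c * (4 * (a + b * j0%:Z + c * j0%:Z ^+ 2)) = (b + 2 * c * j0%:Z) ^+ 2 - p%:Z ^+ 2 * M.
  by rewrite -dM; ring.
by apply: rpredB; [apply: dvdz_exp2r | apply: dvdz_mulr].
Qed.

(** At 2 the double zero lifts exactly when the discriminant divided by 4 is
    again 0 or 1 modulo 4. *)
Lemma double_root_count_2 (a b c M : int) :
  ~ [/\ (2%:Z %| a)%Z, (2%:Z %| b)%Z & (2%:Z %| c)%Z] -> b ^+ 2 - 4 * a * c = 4 * M ->
  (M %% 4)%Z = 0 \/ (M %% 4)%Z = 1 ->
  \sum_(j < 2) (double_root 2 a b c j%:Z)%:R + ((2%:Z %| b)%Z && (4 %| c)%Z)%:R = 1%R :> int.
Proof.
move=> prim dM M4; rewrite !big_ord_recl big_ord0 addr0 /double_root /=.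
rewrite -[Posz 0]/(0 : int) -[Posz (bump 0 0)]/(1 : int).
rewrite !(mulr0, addr0, expr0n, expr1n, mulr1) /=.
rewrite -[2%:Z ^+ 2]/(4 : int).
have [b1 Eb] : exists b1, b = 2 * b1.
  have : (b ^+ 2 %% 2)%Z = 0 by rewrite -mulrA in dM; lia.
  by rewrite sqr_mod2 => ?; exists (b %/ 2)%Z; lia.
have EM : b1 ^+ 2 - a * c = M by rewrite Eb in dM; lia.
have sq := sqr_mod4 b1; have sq2 := sqr_mod2 b1.
have ac : ((a * c) %% 4)%Z = ((a %% 4)%Z * (c %% 4)%Z %% 4)%Z by rewrite modzMm.
have nac : ~~ ((2%:Z %| a)%Z && (2%:Z %| c)%Z).
  by apply/negP => /andP[pa pc]; apply: prim; split=> //; rewrite Eb dvdz_mulr.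
rewrite Eb; move: EM sq sq2 ac nac M4; clear; move: (b1 ^+ 2) (a * c) => b2 P EM sq sq2 ac nac M4.
have : (a %% 4)%Z \in [:: 0; 1; 2; 3 : int] by rewrite !inE; clear; lia.
have : (c %% 4)%Z \in [:: 0; 1; 2; 3 : int] by rewrite !inE; clear; lia.
have [Eb1|Eb1] : (b1 %% 2)%Z = 0 \/ (b1 %% 2)%Z = 1 by clear; lia.
- rewrite !inE => /or4P[]/eqP Ec /or4P[]/eqP Ea; rewrite Ea Ec in ac; lia.
- rewrite !inE => /or4P[]/eqP Ec /or4P[]/eqP Ea; rewrite Ea Ec in ac; lia.
Qed.

Lemma double_root_count (p : nat) (a b c M : int) : prime p ->
  ~ [/\ (p%:Z %| a)%Z, (p%:Z %| b)%Z & (p%:Z %| c)%Z] -> b ^+ 2 - 4 * a * c = p%:Z ^+ 2 * M ->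
  (p = 2%N -> (M %% 4)%Z = 0 \/ (M %% 4)%Z = 1) ->
  \sum_(j < p) (double_root p a b c j%:Z)%:R + ((p%:Z %| b)%Z && (p%:Z ^+ 2 %| c)%Z)%:R = 1%R :> int.
Proof.
move=> pp; case: (even_prime pp) => [E|op].
  by subst p => prim dM /(_ erefl); apply: double_root_count_2.
by move=> prim dM _; apply: double_root_count_odd dM.
Qed.

(** * The Hecke correspondence at p *)

(** Representatives of the integral matrices of determinant p modulo Gamma0(N)
    on the left: the line spanned by (1, k) for k < p, and the line spanned by
    (0, 1) for k = p. The zero entry below the diagonal makes them independent
    of N. *)
Definition line_mat (p k : nat) : level_mat :=
  if k == p then (p%:Z, 0, 0, 1) else (1, k%:Z, 0, p%:Z).

Lemma gdet_line N p k : gdet N (line_mat p k) = p%:Z.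
Proof. by rewrite /line_mat; case: ifP => _ /=; ring. Qed.

Lemma gscalarC N k g : gmul N (gscalar k) g = gmul N g (gscalar k).
Proof. by case: g => [[[x y] z] t] /=; congr (_, _, _, _); ring. Qed.

Lemma gdetN1 N : gdet N (gscalar (-1)) = 1.
Proof. by rewrite /=; ring. Qed.

Lemma gadj_gscalar k : gadj (gscalar k) = gscalar k.
Proof. by rewrite /= oppr0. Qed.

Section Lines.
Variables (N p : nat).
Hypotheses (pp : prime p) (pN : ~~ (p %| N)%N).

(** The rows of g span a line modulo p; dividing g by the representative of
    that line leaves an integral matrix. *)
Lemma line_rep g : gdet N g = p%:Z ->
  exists (l : 'I_p.+1) h, gdet N h = 1 /\ g = gmul N h (line_mat p l).
Proof.
move=> dg; have p0 : p%:Z != 0 by have := prime_gt0 pp; clear; lia.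
suff [l [h E]] : exists (l : 'I_p.+1) h, g = gmul N h (line_mat p l).
  exists l, h; split=> //; apply: (mulIf p0); rewrite mul1r -{2}dg E gdet_mul gdet_line //.
case: g dg => [[[x y] z] t] /= dg.
have Gauss u v : ~~ (p%:Z %| u)%Z -> (p%:Z %| u * v)%Z -> (p%:Z %| v)%Z.
  by move=> pu; rewrite Gauss_dvdzr // coprimezE /= prime_coprime // -[(p %| _)%N]/(p%:Z %| u)%Z.
have fin (j : 'I_p) : (p%:Z %| y - x * j%:Z)%Z -> (p%:Z %| t - N%:Z * z * j%:Z)%Z ->
    exists (l : 'I_p.+1) h, (x, y, z, t) = gmul N h (line_mat p l).
  move=> /dvdzP[y' Ey] /dvdzP[t' Et].
  exists (widen_ord (leqnSn p) j), (x, y', z, t'); rewrite /line_mat /= ltn_eqF //=.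
  congr (_, _, _, _); try ring.
    by rewrite -[LHS](subrK (x * j%:Z)) Ey; ring.
  by rewrite -[LHS](subrK (N%:Z * z * j%:Z)) Et; ring.
have [px|px] := boolP (p%:Z %| x)%Z; last first.
  have pNx : ~~ (p%:Z %| - x)%Z by rewrite rpredN.
  have [j Hj] := ord_div_ex y pp pNx; rewrite mulNr in Hj.
  apply: (fin j Hj); apply: (Gauss x) => //.
  have -> : x * (t - N%:Z * z * j%:Z) = (x * t - N%:Z * y * z) + N%:Z * z * (y - x * j%:Z) by ring.
  by rewrite dg; apply: rpredD; [exact: dvdzz | exact: dvdz_mull].
have [pz|pz] := boolP (p%:Z %| z)%Z; last first.
  have pNz : ~~ (p%:Z %| N%:Z * z)%Z by apply: contra pz => /Gauss; apply.
  have pNz' : ~~ (p%:Z %| - (N%:Z * z))%Z by rewrite rpredN.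
  have [j Hj] := ord_div_ex t pp pNz'; rewrite mulNr in Hj.
  apply: (fin j) => //; apply: (Gauss (N%:Z * z)) => //.
  have -> : N%:Z * z * (y - x * j%:Z) = x * (t - N%:Z * z * j%:Z) - (x * t - N%:Z * y * z) by ring.
  by rewrite dg; apply: rpredB; [exact: dvdz_mull | exact: dvdzz].
case/dvdzP: px => x' ->; case/dvdzP: pz => z' ->.
exists ord_max, (x', y, z', t); rewrite /line_mat /= eqxx.
by congr (_, _, _, _); ring.
Qed.

Lemma line_uniq (l l' : 'I_p.+1) h : gdet N h = 1 ->
  gmul N h (line_mat p l) = line_mat p l' -> l = l'.
Proof.
case: h => [[[x y] z] t] /= dh; have p1 := prime_gt1 pp.
rewrite /line_mat; case: eqP => [El|/eqP El]; case: eqP => [El'|/eqP El'] /=.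
- by move=> _; apply: val_inj; rewrite /= El El'.
- case=> E _ _ _; exfalso; have : (p%:Z %| 1)%Z by apply/dvdzP; exists x; move: E; clear; lia.
  by rewrite dvdz1 /=; clear -p1; lia.
- case=> _ _ Ez E; exfalso; have z0 : z = 0 by rewrite -Ez; ring.
  have : (p%:Z %| 1)%Z by apply/dvdzP; exists t; rewrite z0 in E; move: E; clear; lia.
  by rewrite dvdz1 /=; clear -p1; lia.
case=> Ex Ey _ _; apply/val_inj => /=.
have x1 : x = 1 by rewrite -Ex; ring.
have lp : (l < p)%N by have := ltn_ord l; rewrite ltnS leq_eqVlt (negbTE El).
have lp' : (l' < p)%N by have := ltn_ord l'; rewrite ltnS leq_eqVlt (negbTE El').
have : (p%:Z %| (l' : nat)%:Z - (l : nat)%:Z)%Z.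
  by apply/dvdzP; exists y; rewrite -Ey x1; ring.
rewrite -eqz_mod_dvd !modz_nat !modn_small // => /eqP [].
by [].
Qed.
End Lines.

(** Used in both directions, for a bijection known only as a relation that is
    total and injective on each side. *)
Lemma card_le_of_relation (T U : finType) (A : pred T) (B : pred U) (R : T -> U -> Prop) :
  (forall x, A x -> exists2 y, B y & R x y) ->
  (forall x x' y, R x y -> R x' y -> x = x') -> (#|A| <= #|B|)%N.
Proof.
move=> tot inj.
pose f x : option U := [pick y | B y && `[< R x y >]].
have fA x : A x -> exists y, [/\ f x = Some y, B y & R x y].
  move=> /tot[y By Rxy]; rewrite /f; case: pickP => [y' /andP[By' /asboolP Rxy']|/(_ y)].
    by exists y'.
  by rewrite By /=; case: asboolP.
have inj_f : {in A &, injective f}.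
  move=> x x' /fA[y [-> _ Rxy]] /fA[y' [-> _ Rxy']] [E].
  by apply: inj Rxy _; rewrite E.
have injS : injective (@Some U) by move=> ? ? [].
rewrite -(card_in_image inj_f) -(card_in_image (f := @Some U) (A := B) (in2W injS)).
apply: subset_leq_card; apply/fintype.subsetP => z /mapP[x]; rewrite mem_enum => Ax ->.
have [y [-> By _]] := fA x Ax; by apply/mapP; exists y; rewrite ?mem_enum.
Qed.

Section Hecke.
Variables (N : nat) (D m : int) (p : nat).
Hypotheses (pN : prime N) (oN : odd N) (D1 : 1 < D) (fD : fundamental_discriminant D).
Hypotheses (sD : square_mod D (4 * N%:Z)) (sm : square_mod m (4 * N%:Z)).
Hypotheses (pp : prime p) (pD : ~~ (p%:Z %| D)%Z) (ppN : ~~ (p %| N)%N).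

Let N0 : (0 < N)%N := prime_gt0 pN.
Let p0 : p%:Z != 0. Proof. by have := prime_gt0 pp; clear; lia. Qed.
Let p2 : p%:Z ^+ 2 != 0. Proof. by rewrite expf_neq0. Qed.
Let p2_gt0 : 0 < p%:Z ^+ 2. Proof. by rewrite lt_def p2 sqr_ge0. Qed.
Let copD : coprimez p%:Z D.
Proof. by rewrite coprimezE /= prime_coprime // -[(p %| _)%N]/(p%:Z %| D)%Z. Qed.

Lemma admissible_line l Q : admissible N D m Q -> admissible N D (m * p%:Z ^+ 2) (act N (line_mat p l) Q).
Proof.
move=> gQ; have := @admissible_act N D m (line_mat p l) Q; rewrite gdet_line => H.
exact: H.
Qed.

Lemma line_uniq_up_to_sign h1 h2 e (l1 l2 : 'I_p.+1) : gdet N h1 = 1 -> gdet N h2 = 1 ->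
  e = gscalar 1 \/ e = gscalar (-1) ->
  gmul N h1 (line_mat p l1) = gmul N e (gmul N h2 (line_mat p l2)) -> l1 = l2.
Proof.
move=> d1 d2 He E; apply: (@line_uniq N p pp l1 l2 (gmul N (gadj (gmul N e h2)) h1)).
  rewrite gdet_mul gdet_adj gdet_mul d1 d2; case: He => ->; rewrite ?gdet1 ?gdetN1 //.
rewrite -gmulA E (gmulA N e) gmulA gmul_adjl gdet_mul d2.
by case: He => ->; rewrite ?gdet1 ?gdetN1 mulr1 gmul1.
Qed.

(** The lines l and l' correspond if some g of determinant p in the class of l
    carries Q to Q' and its adjugate lies in the class of l'. As the
    stabilizers of Q and Q' are {I, -I}, g is determined up to sign by either
    line. *)
Lemma hecke_correspondence_sym Q Q' : admissible N D m Q -> admissible N D (m * p%:Z ^+ 2) Q' ->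
  #|[pred l : 'I_p.+1 | equivf N (act N (line_mat p l) Q) Q']| =
  #|[pred l : 'I_p.+1 | equivf N (act N (line_mat p l) Q') (scale (p%:Z ^+ 2) Q)]|.
Proof.
move=> gQ gQ'.
pose R (l l' : 'I_p.+1) := exists h k, [/\ gdet N h = 1, gdet N k = 1,
   act N (gmul N h (line_mat p l)) Q = Q' & gadj (gmul N h (line_mat p l)) = gmul N k (line_mat p l')].
have inj1 l1 l2 l' : R l1 l' -> R l2 l' -> l1 = l2.
  move=> [h1 [k1 [dh1 dk1 E1 F1]]] [h2 [k2 [dh2 dk2 E2 F2]]].
  pose e := gmul N k1 (gadj k2).
  have de : gdet N e = 1 by rewrite gdet_mul gdet_adj dk1 dk2.
  have Ee : gadj (gmul N h1 (line_mat p l1)) = gmul N e (gadj (gmul N h2 (line_mat p l2))).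
    by rewrite F1 F2 /e -gmulA (gmulA N (gadj k2)) gmul_adjl dk2 gmul1.
  have /(congr1 (fun g => act N g Q')) := Ee.
  rewrite act_mul -{1}E1 -{1}E2 !act_adjK !gdet_mul dh1 dh2 !gdet_line !mul1r act_scale.
  move=> /(scale_inj p2) /esym /(stabilizer_trivial pN D1 fD gQ de) He.
  have /(congr1 gadj) := Ee; rewrite gadjK (gadj_mul N e) gadjK => E.
  apply: (line_uniq_up_to_sign dh1 dh2 He); rewrite E.
  by case: He => ->; rewrite gadj_gscalar gscalarC.
have inj2 l l1' l2' : R l l1' -> R l l2' -> l1' = l2'.
  move=> [h1 [k1 [dh1 dk1 E1 F1]]] [h2 [k2 [dh2 dk2 E2 F2]]].
  pose e := gmul N h1 (gadj h2).
  have de : gdet N e = 1 by rewrite gdet_mul gdet_adj dh1 dh2.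
  have Ee : gmul N h1 (line_mat p l) = gmul N e (gmul N h2 (line_mat p l)).
    by rewrite /e -gmulA (gmulA N (gadj h2)) gmul_adjl dh2 gmul1.
  have := E1; rewrite Ee act_mul E2 => /(stabilizer_trivial pN D1 fD gQ' de) He.
  have /(congr1 gadj) := Ee; rewrite F1 (gadj_mul N e) F2 => E.
  apply: (line_uniq_up_to_sign dk1 dk2 He); rewrite E.
  by case: He => ->; rewrite gadj_gscalar gscalarC.
have tot1 (l : 'I_p.+1) : equivf N (act N (line_mat p l) Q) Q' ->
    exists2 l' : 'I_p.+1, equivf N (act N (line_mat p l') Q') (scale (p%:Z ^+ 2) Q) & R l l'.
  case/asboolP => h dh EQ'; set g := gmul N h (line_mat p l).
  have dg : gdet N (gadj g) = p%:Z by rewrite gdet_adj gdet_mul dh gdet_line mul1r.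
  have [l' [k [dk Ek]]] := line_rep pp ppN dg.
  have Eg : act N g Q = Q' by rewrite act_mul EQ'.
  exists l'; last by exists h, k.
  apply/asboolP; exists k => //.
  by rewrite -act_mul -Ek -Eg act_adjK -gdet_adj dg.
have tot2 (l' : 'I_p.+1) : equivf N (act N (line_mat p l') Q') (scale (p%:Z ^+ 2) Q) ->
    exists2 l : 'I_p.+1, equivf N (act N (line_mat p l) Q) Q' & R l l'.
  case/asboolP => k dk EQ; pose g := gadj (gmul N k (line_mat p l')).
  have dg : gdet N g = p%:Z by rewrite gdet_adj gdet_mul dk gdet_line mul1r.
  have Eg : act N g Q = Q'.
    apply: (scale_inj p2); rewrite -act_scale EQ -[act N k _]act_mul act_adjK.
    by rewrite gdet_mul dk gdet_line mul1r.
  have [l [h [dh Eh]]] := line_rep pp ppN dg.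
  exists l; last by exists h, k; split; rewrite // -Eh // /g gadjK.
  by apply/asboolP; exists h; rewrite // -act_mul -Eh.
apply/eqP; rewrite eqn_leq; apply/andP; split.
  by apply: (card_le_of_relation (R := R)).
by apply: (card_le_of_relation (R := fun l' l => R l l')) => [l' /tot2|l' l'' l H H']; [|exact: inj2 H H'].
Qed.

Variables (s s' : seq form).
Hypotheses (sg : forall Q, Q \in s -> admissible N D m Q)
           (s1 : forall Q, admissible N D m Q -> count (equivf N Q) s = 1%N).
Hypotheses (s'g : forall Q, Q \in s' -> admissible N D (m * p%:Z ^+ 2) Q)
           (s'1 : forall Q, admissible N D (m * p%:Z ^+ 2) Q -> count (equivf N Q) s' = 1%N).

Let chi := genus_char D N.
Let sm' := square_modM p%:Z sm.

Lemma equivf_sym Q Q' : equivf N Q Q' = equivf N Q' Q.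
Proof. by apply/idP/idP => /(equivfP _ _ N0) /(orbit_of_sym N0) /(equivfP _ _ N0). Qed.

Lemma chi_equivf M Q Q' : square_mod M (4 * N%:Z) -> admissible N D M Q -> equivf N Q Q' -> chi Q' = chi Q.
Proof.
move=> sM gQ /asboolP[g dg ->]; apply: (genus_char_act pN oN D1 fD sD sM gQ); rewrite dg //.
by rewrite coprimezE /= coprime1n.
Qed.

Lemma chi_line l Q : admissible N D m Q -> chi (act N (line_mat p l) Q) = chi Q.
Proof. by move=> gQ; apply: (genus_char_act pN oN D1 fD sD sm gQ); rewrite gdet_line. Qed.

Lemma sum_indicator (F : pred form) (t : seq form) : \sum_(Q <- t) (F Q)%:R = (count F t)%:R :> int.
Proof. by rewrite -sum1_count natr_sum [RHS]big_mkcond; apply: eq_bigr => Q _; case: (F Q). Qed.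

Lemma card_as_sum (P : pred 'I_p.+1) : (#|P|)%:R = \sum_l (P l)%:R :> int.
Proof.
rewrite -sum1_card natr_sum [LHS]big_mkcond; apply: eq_bigr => l _.
by have -> : (l \in P) = P l by []; case: (P l). Qed.

(** The multiplicity u(Q') with which the class of Q' enters the Hecke
    relation. *)
Definition line_count (Q' : form) : int :=
  \sum_(l < p.+1) (`[< form_dvd (p%:Z ^+ 2) (act N (line_mat p l) Q') >])%:R.

Lemma equivf_scale k Q Q' : k != 0 -> equivf N (scale k Q) (scale k Q') = equivf N Q Q'.
Proof.
move=> k0; apply/asboolP/asboolP => -[g dg]; last by move->; exists g; rewrite ?act_scale.
by rewrite act_scale => /(scale_inj k0) ->; exists g.
Qed.

(** Both sides count pairs of classes joined by a line, weighted by chi, which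
    takes the same value at the two ends: each Q has p + 1 lines, and the
    lines of Q' that lead to p^2 times a form are counted by line_count. *)
Lemma hecke_sum : (p%:Z + 1) * (\sum_(Q <- s) chi Q) = \sum_(Q' <- s') chi Q' * line_count Q'.
Proof.
pose n Q Q' : int := \sum_(l < p.+1) (equivf N (act N (line_mat p l) Q) Q')%:R.
pose n' Q' Q : int := \sum_(l < p.+1) (equivf N (act N (line_mat p l) Q') (scale (p%:Z ^+ 2) Q))%:R.
have nn' Q Q' : Q \in s -> Q' \in s' -> n Q Q' = n' Q' Q.
  by move=> /sg gQ /s'g gQ'; rewrite /n /n' -!card_as_sum hecke_correspondence_sym.
have E1 Q : Q \in s -> \sum_(Q' <- s') n Q Q' = p%:Z + 1.
  move=> /sg gQ; rewrite /n exchange_big /=.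
  under eq_bigr => l _ do rewrite sum_indicator (s'1 (admissible_line l gQ)).
  by rewrite mulr1n sumr_const card_ord -natr1 natz.
have E2 Q' : Q' \in s' -> \sum_(Q <- s) n' Q' Q = line_count Q'.
  move=> /s'g gQ'; rewrite /n' exchange_big /=; apply: eq_bigr => l _.
  rewrite sum_indicator; case: asboolP => [/form_dvd_scaleE[R ER]|nd].
    rewrite ER; under eq_count => Q do rewrite equivf_scale //.
    rewrite s1 //; apply: (@admissible_unscale N D m (p%:Z ^+ 2)) => //; rewrite -ER.
    have := @admissible_act N D (m * p%:Z ^+ 2) (line_mat p l) Q'; rewrite gdet_line => /(_ p0 copD gQ').
    by rewrite -mulrA -expr2.
  rewrite (eq_count (a2 := pred0)) ?count_pred0 // => Q /=.
  apply/asboolP => -[g dg E]; apply: nd; apply/form_dvd_scaleE.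
  exists (act N (gadj g) Q); rewrite -act_scale E act_adjK dg expr1n scale1 //.
rewrite mulr_sumr; transitivity (\sum_(Q <- s) \sum_(Q' <- s') chi Q' * n Q Q').
  rewrite big_seq [RHS]big_seq; apply: eq_bigr => Q Qs.
  rewrite mulrC -(E1 Q Qs) mulr_sumr big_seq [RHS]big_seq; apply: eq_bigr => Q' Qs'.
  rewrite /n !mulr_sumr; apply: eq_bigr => l _.
  case: (boolP (equivf N _ _)) => [H|]; last by rewrite !mulr0.
  by rewrite (chi_equivf sm' (admissible_line l (sg Qs)) H) chi_line //; apply: sg.
rewrite exchange_big /= big_seq [RHS]big_seq; apply: eq_bigr => Q' Qs'.
rewrite -mulr_sumr -E2 //; congr (_ * _).
by rewrite big_seq [RHS]big_seq; apply: eq_bigr => Q Qs; apply: nn'.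
Qed.

Lemma act_line_lt k Q : (k < p)%N -> act N (line_mat p k) Q =
  (coefa Q + coefb Q * k%:Z + N%:Z * coefc Q * k%:Z ^+ 2,
   p%:Z * (coefb Q + 2 * (N%:Z * coefc Q) * k%:Z), p%:Z ^+ 2 * coefc Q).
Proof.
move=> kp; rewrite /line_mat ltn_eqF //; case: Q => [[a b] c]; rewrite /coefa /coefb /coefc /=.
by congr (_, _, _); ring.
Qed.

Lemma act_line_p Q : act N (line_mat p p) Q = (p%:Z ^+ 2 * coefa Q, p%:Z * coefb Q, coefc Q).
Proof.
rewrite /line_mat eqxx; case: Q => [[a b] c]; rewrite /coefa /coefb /coefc /=.
by congr (_, _, _); ring.
Qed.

Lemma dvdN (k : nat) c : (p%:Z ^+ k %| N%:Z * c)%Z = (p%:Z ^+ k %| c)%Z.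
Proof.
by rewrite Gauss_dvdzr // coprimezXl // coprimezE /= prime_coprime.
Qed.

Lemma line_count_primitive Q' : admissible N D (m * p%:Z ^+ 2) Q' -> ~ form_dvd p%:Z Q' -> line_count Q' = 1.
Proof.
move=> gQ' nd; rewrite /line_count big_ord_recr /=.
(* this enters only for p = 2, where D m has to be 0 or 1 modulo 4 *)
have m4 : (m %% 4)%Z = 0 \/ (m %% 4)%Z = 1.
  by apply: square_mod_4; apply: square_mod_dvd sm; rewrite dvdz_mulr.
rewrite -[RHS](@double_root_count p (coefa Q') (coefb Q') (N%:Z * coefc Q') (D * m)) //; first 1 last.
- by case=> pa pb pc; apply: nd; split=> //; have := dvdN 1 (coefc Q'); rewrite expr1 => <-.
- transitivity (disc N Q'); first by rewrite /disc; ring.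
  by have [_ -> _] := gQ'; ring.
- move=> E; have D4 : (D %% 4)%Z = 1.
    case: (fundamental_discriminant_at2 fD) => [//|[k [Dk _]]].
    by move: pD; rewrite E Dk; clear; lia.
  by rewrite -modzMm D4 mul1r modz_mod.
congr (_ + _).
  apply: eq_bigr => j _; congr (_%:R); congr (nat_of_bool _).
  rewrite act_line_lt //; apply/asboolP/andP => [[/= H1 H2 _]|[H1 H2]]; split=> //=.
  - by move: H2; rewrite /coefb /= expr2 dvdz_mul2l //.
  - by rewrite /coefb /= expr2 dvdz_mul2l //.
  - by rewrite /coefc /= dvdz_mulr.
congr (_%:R); congr (nat_of_bool _); rewrite act_line_p dvdN.
apply/asboolP/andP => [[/= _ H1 H2]|[H1 H2]]; split=> //=.
- by move: H1; rewrite /coefb /= expr2 dvdz_mul2l //.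
- by rewrite /coefa /= dvdz_mulr.
- by rewrite /coefb /= expr2 dvdz_mul2l //.
Qed.

Lemma form_dvd_scale2 k Q : k != 0 -> form_dvd (k ^+ 2) (scale k Q) <-> form_dvd k Q.
Proof.
move=> k0; case: Q => [[a b] c]; rewrite /form_dvd /coefa /coefb /coefc /= expr2.
by rewrite !dvdz_mul2l.
Qed.

Lemma line_count_scale Q : admissible N D m Q ->
  (p%:Z %| line_count (scale p%:Z Q) - (1 + kronecker_prime (D * m) p))%Z.
Proof.
move=> gQ; have [_ dQ _] := gQ.
have := @root_count p (coefa Q) (coefb Q) (N%:Z * coefc Q) pp.
have -> : coefb Q ^+ 2 - 4 * coefa Q * (N%:Z * coefc Q) = D * m by rewrite -dQ /disc; ring.
suff -> : line_count (scale p%:Z Q) = \sum_(j < p)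
   ((p%:Z %| (coefa Q + coefb Q * j%:Z + N%:Z * coefc Q * j%:Z ^+ 2))%Z)%:R
     + ((p%:Z %| N%:Z * coefc Q)%Z)%:R by [].
rewrite /line_count big_ord_recr /=; congr (_ + _).
  apply: eq_bigr => j _; congr (_%:R); congr (nat_of_bool _).
  rewrite act_scale; apply/asboolP/idP => [/(form_dvd_scale2 _ p0)|H]; rewrite ?act_line_lt //.
    by case.
  apply/(form_dvd_scale2 _ p0); split=> //.
    by rewrite /coefb /= dvdz_mulr.
  by rewrite /coefc /= expr2 -mulrA dvdz_mulr.
congr (_%:R); congr (nat_of_bool _); rewrite act_scale -[p%:Z in RHS]expr1 dvdN expr1.
apply/asboolP/idP => [/(form_dvd_scale2 _ p0)|H]; rewrite ?act_line_p.
  by case.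
apply/(form_dvd_scale2 _ p0); split=> //.
  by rewrite /coefa /= expr2 -mulrA dvdz_mulr.
by rewrite /coefb /= dvdz_mulr.
Qed.

(** Multiplication by p is a bijection from the classes of discriminant D m to
    the classes of multiples of p of discriminant D m p^2. *)
Lemma sum_imprimitive :
  \sum_(Q' <- s') chi Q' * (`[< form_dvd p%:Z Q' >])%:R = \sum_(Q <- s) chi (scale p%:Z Q).
Proof.
have pgt0 : 0 < p%:Z by have := prime_gt0 pp.
transitivity (\sum_(Q' <- s') \sum_(Q <- s) chi (scale p%:Z Q) * (equivf N Q' (scale p%:Z Q))%:R).
  rewrite big_seq [RHS]big_seq; apply: eq_bigr => Q' Qs'; have gQ' := s'g Qs'.
  transitivity (\sum_(Q <- s) chi Q' * (equivf N Q' (scale p%:Z Q))%:R); last first.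
    apply: eq_bigr => Q _; case: (boolP (equivf N _ _)) => [H|]; last by rewrite !mulr0.
    by rewrite (chi_equivf sm' gQ' H).
  rewrite -mulr_sumr sum_indicator; congr (_ * _).
  case: asboolP => [/form_dvd_scaleE[R ER]|nd].
    rewrite ER; under eq_count => Q do rewrite equivf_scale //.
    by rewrite s1 //; apply: (@admissible_unscale N D m p%:Z) => //; rewrite -ER.
  rewrite (eq_count (a2 := pred0)) ?count_pred0 // => Q /=.
  apply/asboolP => -[g dg E]; apply: nd; apply/form_dvd_scaleE.
  by exists (act N (gadj g) Q); rewrite -act_scale E act_adjK dg expr1n scale1.
rewrite exchange_big /= big_seq [RHS]big_seq; apply: eq_bigr => Q /sg gQ.
rewrite -mulr_sumr sum_indicator; under eq_count => Q' do rewrite equivf_sym.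
by rewrite s'1 ?mulr1 //; apply: admissible_scale.
Qed.

(** Reduce hecke_sum modulo p with the two values of line_count; the symbol
    (D/p) appears twice, in the count of zeros and in chi(p Q), and
    cancels. *)
Lemma hecke_congruence :
  (p%:Z %| (\sum_(Q' <- s') chi Q') - (1 - kronecker m p%:Z) * (\sum_(Q <- s) chi Q))%Z.
Proof.
set S := \sum_(Q <- s) _; set S' := \sum_(Q' <- s') _.
have pgt0 := prime_gt0 pp.
have kE a : kronecker a p%:Z = kronecker_prime a p by rewrite kronecker_jacobi // jacobi_prime.
set kap := kronecker_prime (D * m) p.
have H1 : (p%:Z %| \sum_(Q' <- s') chi Q' * line_count Q' -
     \sum_(Q' <- s') chi Q' * (1 + (`[< form_dvd p%:Z Q' >])%:R * kap))%Z.
  rewrite -sumrB big_seq; apply: rpred_sum => Q' /s'g gQ'; rewrite -mulrBr; apply: dvdz_mull.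
  case: asboolP => [/form_dvd_scaleE[R ER]|nd]; last by rewrite line_count_primitive // mul0r addr0 subrr dvdz0.
  rewrite mul1r ER; apply: line_count_scale; apply: (@admissible_unscale N D m p%:Z) => //; by rewrite -ER.
have E : \sum_(Q' <- s') chi Q' * (1 + (`[< form_dvd p%:Z Q' >])%:R * kap) = S' + kronecker m p%:Z * S.
  under eq_bigr => Q' _ do rewrite mulrDr mulr1 mulrA.
  rewrite big_split /= -mulr_suml sum_imprimitive; congr (_ + _).
  have -> : \sum_(Q <- s) chi (scale p%:Z Q) = kronecker D p%:Z * S.
    rewrite /S mulr_sumr big_seq [RHS]big_seq; apply: eq_bigr => Q /sg gQ.
    exact: (genus_char_scale pN oN D1 fD sD sm gQ pp pD).
  have DD : kronecker D p%:Z * kronecker D p%:Z = 1.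
    by rewrite kronecker_jacobi // jacobi_mulxx // coprimez_sym.
  rewrite /kap kronecker_primeM // -!kE.
  transitivity ((kronecker D p%:Z * kronecker D p%:Z) * (kronecker m p%:Z * S)); first by ring.
  by rewrite DD mul1r.
rewrite E -hecke_sum -/S in H1.
have -> : S' - (1 - kronecker m p%:Z) * S = p%:Z * S - ((p%:Z + 1) * S - (S' + kronecker m p%:Z * S)) by ring.
by apply: rpredB => //; apply: dvdz_mulr.
Qed.
End Hecke.

Theorem corollary4p5 (N : nat) (hN : N \in [:: 11; 17; 19]%N)
  (D : int) (hD1 : 1 < D) (hDfund : fundamental_discriminant D)
  (hDsq : square_mod D (4 * N%:Z))
  (p : nat) (hp : prime p) (hpD : ~~ (p%:Z %| D)%Z) (hpN : ~~ (p %| N)%N)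
  (d : int) (hd0 : 0 < d) (hdsq : square_mod (- d) (4 * N%:Z)) :
  [/\ kronecker (- d) p%:Z = 1 ->
        eqmod_rat p (twisted_class_number N D (d * p%:Z ^+ 2)) 0,
      kronecker (- d) p%:Z = 0 ->
        eqmod_rat p (twisted_class_number N D (d * p%:Z ^+ 2))
                    (twisted_class_number N D d) &
      kronecker (- d) p%:Z = -1 ->
        eqmod_rat p (twisted_class_number N D (d * p%:Z ^+ 2))
                    (2 * twisted_class_number N D d)].
Proof.
have [pN oN] : prime N /\ odd N by move: hN; rewrite !inE => /or3P[] /eqP ->.
have [s [sg s1 ->]] := class_representatives d pN hD1 hDfund.
have [s' [s'g s'1 ->]] := class_representatives (d * p%:Z ^+ 2) pN hD1 hDfund.
rewrite -mulNr in s'g s'1.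
have /dvdzP[k Ek] := hecke_congruence pN oN hD1 hDfund hDsq hdsq hp hpD hpN sg s1 s'g s'1.
move: (\sum_(Q <- s) _) (\sum_(Q <- s') _) Ek => S S' Ek.
have {}Ek : S' = (1 - kronecker (- d) p%:Z) * S + p%:Z * k.
  by rewrite -[LHS](subrK ((1 - kronecker (- d) p%:Z) * S)) Ek; ring.
split=> Ekr; exists k; rewrite Ek Ekr; ring.
Qed.
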